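(* Let $(M,c)$ be a Riemannian conformal structure on a manifold $M$ of dimension $n\geq 2$, $g\in c$, and $\alpha\colon\mathbb{R}\to\mathcal{T}_{(1,1)}M$ an admissible smooth $1$-parameter family; let $(\widetilde M,\widetilde g)$ be the Lorentzian manifold constructed from $g$ and $\alpha$, and $\iota_g\colon\mathcal{Q}\to\widetilde M$ the embedding of the scale bundle, whose image is $\{\rho=0\}$. Then the Ricci tensor $\widetilde{\mathrm{Ric}}$ of $(\widetilde M,\widetilde g)$ satisfies $$\widetilde{\mathrm{Ric}}|_{\iota_g(\mathcal{Q})}(V,W)=\mathrm{Ric}^g(V,W)-\frac{\mathrm{trace}(\dot\alpha(0))}{2}g(V,W)-\frac{n-2}{2}\,g(\dot\alpha(0)(V),W)$$ for all $V,W\in\mathfrak{L}(M)$. Moreover: (i) if $n=2$, then $\widetilde{\mathrm{Ric}}|_{\iota_g(\mathcal{Q})}(T\iota_g\cdot\xi,T\iota_g\cdot\eta)=0$ for all $\xi,\eta\in\mathfrak{X}(\mathcal{Q})$ if and only if $\mathrm{trace}(\dot\alpha(0))=2K^g$, where $K^g$ is the Gauss curvature of $g$; (ii) if $n\ge3$, then $\widetilde{\mathrm{Ric}}|_{\iota_g(\mathcal{Q})}(T\iota_g\cdot\xi,T\iota_g\cdot\eta)=0$ for all $\xi,\eta\in\mathfrak{X}(\mathcal{Q})$ if and only if $g(\dot\alpha(0)(-),-)=2P^g$, where $P^g$ is the Schouten tensor of $g$.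
   Context: Manifolds are smooth, Hausdorff, second countable, without boundary. A Riemannian conformal structure $(M,c)$ is an equivalence class $c$ of Riemannian metrics on $M$, where $g\sim g'$ iff $g'=e^{2u}g$ for some $u\in C^\infty(M)$. $\mathcal{T}_{(1,1)}M$ denotes the endomorphism fields of $TM$. Admissible family. A smooth $1$-parameter family $\alpha\colon\mathbb{R}\to\mathcal{T}_{(1,1)}M$ (with derivative $\dot\alpha(\rho)$ in $\rho$) is admissible if each $\alpha(\rho)$ is self-adjoint with respect to any $g\in c$, $\alpha(0)=\mathrm{Id}$, and there is $\delta>0$ such that $\alpha(\rho)$ is nonsingular for $|\rho|<\delta$. Construction. $\widetilde M=\mathbb{R}^+\times(-\delta,\delta)\times M$ with coordinates $(t,\rho)$ on the first two factors, and $$\widetilde g=d(\rho t)\otimes dt+dt\otimes d(\rho t)+t^2\,g(\alpha(\rho)(-),-),$$ a Lorentzian metric. $\mathfrak{L}(M)\subset\mathfrak{X}(\widetilde M)$ is the set of natural lifts to $\widetilde M$ of vector fields on $M$; a vector field on $M$ and its lift are denoted by the same letter. Scale bundle. $\pi\colon\mathcal{Q}\to M$ is the principal $\mathbb{R}^+$-bundle whose fiber over $x$ consists of the values $g_x$ of the metrics $g\in c$ (so every element is $t^2g_x$ with $t>0$, $x\in M$), embedded by $\iota_g(t^2g_x)=(t,0,x)$. $\mathrm{Ric}^g$ and $\mathrm{scal}^g$ are the Ricci tensor and scalar curvature of $g$, and for $n\ge3$ the Schouten tensor is $P^g=\frac1{n-2}\big(\mathrm{Ric}^g-\frac{\mathrm{scal}^g}{2(n-1)}g\big)$.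 The sign convention for the Ricci tensor is the standard one (positive on round spheres). *)

(* Defs.v *)
From HB Require Import structures.
From mathcomp Require Import all_boot all_order all_algebra.
From mathcomp Require Import all_classical all_reals all_analysis.

Set Implicit Arguments.
Unset Strict Implicit.
Unset Printing Implicit Defensive.

Import Order.TTheory GRing.Theory Num.Theory.
Import numFieldNormedType.Exports.

Local Open Scope classical_set_scope.
Local Open Scope ring_scope.

(* k-fold Frechet differentiability on U: in finite dimension the derivative
   of f is differentiable iff all the maps y |-> 'D_v f y are. *)
Fixpoint diff_on (R : realType) (V W : normedModType R) (k : nat)
    (U : set V) (f : V -> W) : Prop :=
  if k is k'.+1 then
    (forall y, U y -> differentiable f y) /\ (forall v, diff_on k' U ('D_v f))
  else True.

Definition smooth_on (R : realType) (V W : normedModType R)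
    (U : set V) (f : V -> W) : Prop := forall k, diff_on k U f.

(* The inverse [cpt i] of the chart [crd i] is a total function which only
   matters on [cod i], the image of the chart. *)
Record charted_space (R : realType) (n : nat) := ChartedSpace {
  points :> topologicalType;
  cidx : Type;
  chart_dom : cidx -> set points;
  crd : cidx -> points -> 'rV[R]_n;
  cpt : cidx -> 'rV[R]_n -> points }.

Section SmoothManifolds.
Context {R : realType} {n : nat} (M : charted_space R n).

Definition cod (i : cidx M) : set 'rV[R]_n := crd i @` chart_dom i.

Definition transition (i j : cidx M) : 'rV[R]_n -> 'rV[R]_n := crd j \o cpt i.

Definition smooth_manifold : Prop :=
  [/\ hausdorff_space M,
      @second_countable M,
      \bigcup_i @chart_dom R n M i = setT,
      forall i : cidx M,
        [/\ open (chart_dom i), open (cod i),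
            {in chart_dom i, cancel (crd i) (cpt i)},
            {in chart_dom i, continuous (crd i)}
          & {in cod i, continuous (cpt i)}]
    & forall i j : cidx M,
        smooth_on (crd i @` (chart_dom i `&` chart_dom j)) (transition i j)].

Definition smooth_function (u : M -> R) : Prop :=
  forall i : cidx M, smooth_on (cod i) (u \o cpt i).

(* Tensor fields are given by their components in the charts, as functions of
   the points of M; [X i x] is meaningless unless [chart_dom i x]. Tangent
   vectors are row vectors, and a linear map A acts on them by v |-> v *m A. *)
Definition components (T : Type) := cidx M -> M -> T.

Definition smooth_components (W : normedModType R) (h : components W) : Prop :=
  forall i, smooth_on (cod i) (h i \o cpt i).

Definition jac (i j : cidx M) (x : M) : 'M[R]_n :=
  'J (transition i j) (crd i x).

Definition vector_field (X : components 'rV[R]_n) : Prop :=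
  smooth_components X /\
  forall i j x, chart_dom i x -> chart_dom j x -> X j x = X i x *m jac i j x.

Definition endomorphism_field (A : components 'M[R]_n) : Prop :=
  smooth_components A /\
  forall i j x, chart_dom i x -> chart_dom j x ->
    jac i j x *m A j x = A i x *m jac i j x.

Definition covariant2_field (h : components 'M[R]_n) : Prop :=
  smooth_components h /\
  forall i j x, chart_dom i x -> chart_dom j x ->
    h i x = jac i j x *m h j x *m (jac i j x)^T.

End SmoothManifolds.

Definition bilin (R : realType) (n : nat) (h : 'M[R]_n) (v w : 'rV[R]_n) : R :=
  (v *m h *m w^T) 0 0.

Section ConformalStructures.
Context {R : realType} {n : nat} (M : charted_space R n).

Definition riemannian_metric (g : components M 'M[R]_n) : Prop :=
  covariant2_field g /\
  forall i x, chart_dom i x ->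
    (forall v w, bilin (g i x) v w = bilin (g i x) w v) /\
    (forall v, v != 0 -> 0 < bilin (g i x) v v).

Definition conformal (g g' : components M 'M[R]_n) : Prop :=
  exists2 u : M -> R, smooth_function u &
    forall i x, chart_dom i x -> g' i x = expR (2 * u x) *: g i x.

Definition conformal_structure (c : set (components M 'M[R]_n)) : Prop :=
  exists2 g0, riemannian_metric g0 &
    c = [set g | riemannian_metric g /\ conformal g0 g].

(* smoothness of a 1-parameter family is joint smoothness in (r, x) *)
Definition smooth_family (alpha : R -> components M 'M[R]_n) : Prop :=
  (forall r, endomorphism_field (alpha r)) /\
  (forall i, smooth_on [set z : 'rV[R]_(1 + n) | cod i (rsubmx z)]
     (fun z : 'rV[R]_(1 + n) => alpha (lsubmx z 0 0) i (cpt i (rsubmx z)))).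

Definition self_adjoint (g A : components M 'M[R]_n) : Prop :=
  forall i x, chart_dom i x -> forall v w,
    bilin (g i x) (v *m A i x) w = bilin (g i x) v (w *m A i x).

Definition nonsingular_within (delta : R) (alpha : R -> components M 'M[R]_n) :=
  forall r, `|r| < delta ->
    forall i x, chart_dom i x -> alpha r i x \in unitmx.

Definition admissible (c : set (components M 'M[R]_n))
    (alpha : R -> components M 'M[R]_n) : Prop :=
  [/\ smooth_family alpha,
      forall r g, c g -> self_adjoint g (alpha r),
      forall i x, chart_dom i x -> alpha 0 i x = 1%:M
    & exists2 delta, 0 < delta & nonsingular_within delta alpha].

Definition family_dot (alpha : R -> components M 'M[R]_n) (r : R) :
    components M 'M[R]_n :=
  fun i x => derive1 (fun s => alpha s i x) r.

(* the bilinear form g(A(-), -) *)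
Definition lowered (g A : components M 'M[R]_n) : components M 'M[R]_n :=
  fun i x => A i x *m g i x.

End ConformalStructures.

Section CurvatureInCoordinates.
Context {R : realType} {n : nat}.
Implicit Types (G : 'rV[R]_n -> 'M[R]_n) (y : 'rV[R]_n).

Definition pderiv (i : 'I_n) (f : 'rV[R]_n -> R) (y : 'rV[R]_n) : R :=
  'D_(delta_mx 0 i) f y.

(* Gamma^k_{ij} *)
Definition christoffel G (k i j : 'I_n) y : R :=
  2^-1 * \sum_l invmx (G y) k l *
    (pderiv i (fun z => G z j l) y + pderiv j (fun z => G z i l) y
     - pderiv l (fun z => G z i j) y).

(* R^l_{kij}, where R(d_i, d_j) d_k = \sum_l R^l_{kij} d_l and
   R(X, Y) = [D_X, D_Y] - D_[X, Y] *)
Definition riemann G (l k i j : 'I_n) y : R :=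
  pderiv i (christoffel G l j k) y - pderiv j (christoffel G l i k) y
  + \sum_m (christoffel G l i m y * christoffel G m j k y
            - christoffel G l j m y * christoffel G m i k y).

(* Ric(Y, Z) = trace (X |-> R(X, Y) Z) *)
Definition ricci_mx G y : 'M[R]_n :=
  \matrix_(j, k) \sum_i riemann G i k i j y.

(* R(u, v) w *)
Definition curvature_op G y (u v w : 'rV[R]_n) : 'rV[R]_n :=
  \row_l \sum_i \sum_j \sum_k riemann G l k i j y * u 0 i * v 0 j * w 0 k.

Definition sectional G y (u v : 'rV[R]_n) : R :=
  bilin (G y) (curvature_op G y u v v) u /
  (bilin (G y) u u * bilin (G y) v v - bilin (G y) u v ^+ 2).

End CurvatureInCoordinates.

Section Curvature.
Context {R : realType} {n : nat} (M : charted_space R n).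
Implicit Types g : components M 'M[R]_n.

Definition Ric g : components M 'M[R]_n :=
  fun i x => ricci_mx (g i \o cpt i) (crd i x).

Definition scal g : components M R :=
  fun i x => \tr (invmx (g i x) *m Ric g i x).

Definition Schouten g : components M 'M[R]_n :=
  fun i x => (n%:R - 2)^-1 *:
    (Ric g i x - (scal g i x / (2 * (n%:R - 1))) *: g i x).

(* meant for n = 2: the sectional curvature of the tangent plane, computed on
   its coordinate basis (d_0, d_1) *)
Definition gauss_curvature g : components M R :=
  fun i x => sectional (g i \o cpt i) (crd i x)
    (\row_(k < n) (k == 0 :> nat)%:R) (\row_(k < n) (k == 1 :> nat)%:R).

End Curvature.

(* the differential of f applied to X, from the chart i around x to the
   chart j around f x *)
Definition tangent_map (R : realType) (m n : nat) (M : charted_space R m)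
    (N : charted_space R n) (f : M -> N) (X : components M 'rV[R]_m)
    (i : cidx M) (j : cidx N) (x : M) : 'rV[R]_n :=
  X i x *m 'J (crd j \o f \o cpt i) (crd i x).

(* an open subset U of the line with its identity chart; the inverse chart
   takes the value p outside of U *)
Definition open_line (R : realType) (U : set R) (p : U) : charted_space R 1 :=
  @ChartedSpace R 1 U unit (fun=> setT)
    (fun _ x => const_mx (val x)) (fun _ y => insubd p (y 0 0)).

Definition prod_space (R : realType) (m n : nat)
    (M : charted_space R m) (N : charted_space R n) : charted_space R (m + n) :=
  @ChartedSpace R (m + n) (M * N)%type (cidx M * cidx N)%type
    (fun k => chart_dom k.1 `*` chart_dom k.2)
    (fun k x => row_mx (crd k.1 x.1) (crd k.2 x.2))
    (fun k y => (cpt k.1 (lsubmx y), cpt k.2 (rsubmx y))).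

Section AmbientSpace.
Context {R : realType} {n : nat} (M : charted_space R n).

Definition pos_set : set R := [set t | 0 < t].

Definition pos_one : pos_set := exist _ 1 (mem_set (ltr01 : pos_set 1)).

Definition sym_set (delta : R) : set R := [set r | - delta < r < delta].

Lemma sym_set0 (delta : R) : 0 < delta -> sym_set delta 0.
Proof. by move=> d0; rewrite /sym_set /= oppr_lt0 d0. Qed.

Definition sym_zero (delta : R) (d0 : 0 < delta) : sym_set delta :=
  exist _ 0 (mem_set (sym_set0 d0)).

Definition ambient (delta : R) (d0 : 0 < delta) :
    charted_space R (1 + (1 + n)) :=
  prod_space (open_line pos_one) (prod_space (open_line (sym_zero d0)) M).

Definition outer (m : nat) (a b : 'rV[R]_m) : 'M[R]_m := a^T *m b.

Definition ambient_metric (delta : R) (d0 : 0 < delta)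
    (g : components M 'M[R]_n) (alpha : R -> components M 'M[R]_n) :
    components (ambient d0) 'M[R]_(1 + (1 + n)) :=
  fun k p =>
    let t := val p.1 in
    let r := val p.2.1 in
    let dt := row_mx 1%:M 0 in
    let drho := row_mx 0 (row_mx 1%:M 0) in
    let drhot := r *: dt + t *: drho in
    outer drhot dt + outer dt drhot
    + t ^+ 2 *: block_mx 0 0 0
                  (block_mx 0 0 0 (lowered g (alpha r) k.2.2 p.2.2)).

Definition natural_lift (delta : R) (d0 : 0 < delta)
    (V : components M 'rV[R]_n) :
    components (ambient d0) 'rV[R]_(1 + (1 + n)) :=
  fun k p => row_mx 0 (row_mx 0 (V k.2.2 p.2.2)).

End AmbientSpace.

Arguments ambient_metric {R n M delta} d0 g alpha k p.
Arguments natural_lift {R n M delta} d0 V k p.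

Section ScaleBundle.
Context {R : realType} {n : nat} (M : charted_space R n).
Variable c : set (components M 'M[R]_n).

(* the bilinear form g_x on the tangent space at x *)
Definition value_at (g : components M 'M[R]_n) (x : M) : cidx M -> 'M[R]_n :=
  fun i => if `[< chart_dom i x >] then g i x else 0.

Record scale_point := Scale {
  point_foot : M;
  point_form : cidx M -> 'M[R]_n;
  form_in_class : exists2 g, c g & point_form = value_at g point_foot }.

HB.instance Definition _ := gen_eqMixin scale_point.
HB.instance Definition _ := gen_choiceMixin scale_point.

Variable g : components M 'M[R]_n.
Hypothesis cg : c g.

Definition section_at (x : M) : scale_point :=
  @Scale x (value_at g x) (ex_intro2 _ _ g cg erefl).

(* the number t > 0 such that q = t^2 g_x *)
Definition scale_factor (q : scale_point) : R :=
  xget 1 [set t | 0 < t /\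
    point_form q = fun i => t ^+ 2 *: value_at g (point_foot q) i].

(* The topology and the smooth structure are those of R^+ * M, through the
   trivialization (t, x) |-> t^2 g_x defined by the section g; another choice
   of g in c leads to the same ones. *)
Definition scale_bundle : charted_space R (1 + n) :=
  @ChartedSpace R (1 + n)
    (initial_topology (fun q : scale_point => (scale_factor q, point_foot q)))
    (cidx M)
    (fun i => [set q : scale_point | chart_dom i (point_foot q)])
    (fun i q => row_mx (const_mx (scale_factor q)) (crd i (point_foot q)))
    (fun i y => let x := cpt i (rsubmx y) in
       xget (section_at x)
         [set q | point_foot q = x /\
            point_form q = fun k => (lsubmx y 0 0) ^+ 2 *: value_at g x k]).

Definition scale_embedding (delta : R) (d0 : 0 < delta) (q : scale_bundle) :
    ambient M d0 :=
  (insubd pos_one (scale_factor q), (sym_zero d0, point_foot q)).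

End ScaleBundle.

Arguments scale_bundle {R n M c g} cg.
Arguments scale_embedding {R n M c g} cg {delta} d0 q.

(* Main.v *)
(* In a chart (t, rho, x) the ambient metric is 2 rho dt^2 + 2 t dt drho + t^2 h
   with h = g(alpha(rho) -, -), a matrix depending only on (rho, x). Writing h'
   for dh/drho, its Christoffel symbols are
     Gamma^t_ij = - t h'_ij / 2,        Gamma^rho_ij = rho h'_ij - h_ij,
     Gamma^rho_{t rho} = 1 / t,         Gamma^i_{t j} = delta_ij / t,
     Gamma^i_{rho j} = (h^-1 h')_ij / 2,
   together with those of the slices h(rho, .), all others being zero. At
   rho = 0 the term rho h'' disappears, the Ricci tensor kills d/dt, and its
   M-block is Ric^g - (n - 2) / 2 h' - tr (h^-1 h') / 2 g with h' = g(alpha' -, -).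
   Ricci flatness along Q therefore means that this last tensor, the "defect",
   vanishes: vectors at a point extend to vector fields by a bump function.
   For n >= 3 a trace turns this into the equation with the Schouten tensor;
   for n = 2 one uses Ric^g = K^g g, that is, the antisymmetry of the Riemann
   tensor, which rests on the symmetry of second derivatives. *)
From HB Require Import structures.
Require Import Defs.
From mathcomp Require Import all_boot all_order all_algebra.
From mathcomp Require Import all_classical all_reals all_analysis.
From mathcomp Require Import ring lra.
Set Implicit Arguments.
Unset Strict Implicit.
Unset Printing Implicit Defensive.
Import Order.TTheory GRing.Theory Num.Theory.
Import numFieldNormedType.Exports.
Local Open Scope classical_set_scope.
Local Open Scope ring_scope.

(** * Smooth functions *)

(** The curvature computation takes place in one chart, for the matrix function [ambient_mx F],
    where F is any smooth family of symmetric invertible matrices in (rho, x). The inverse charts of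
    the half-line and of the interval take a default value outside their images, so the ambient
    metric read in a chart agrees with such a matrix only on an open set; since curvature is local,
    this is enough. The Christoffel symbols are established on that whole open set, because they are
    differentiated afterwards; only the derivatives are specialised to rho = 0. Vectors tangent to Q
    have no rho component, hence no Ricci component along d/drho is ever computed. In the M-block
    all powers of t cancel, so the defect is a function of x alone: flatness can be tested at one
    point of each fibre, on lifts of vector fields of M with zero t component. Smoothness means
    differentiability to every order, and is therefore proved by induction on the order, each class
    of functions being shown stable under derivation. *)

Section Differentiability.
Context {R : realType}.
Implicit Types V W : normedModType R.

Lemma near_eq_differentiable V W (f g : V -> W) x :
  {near x, f =1 g} -> differentiable f x -> differentiable g x.
Proof.
move=> fg df; have [dfc dfE] := (diff_locallyP _ _).1 df.
(* The first-order expansion of f is also one of g, with the same linear part. *)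
have key : g \o shift x = cst (g x) + 'd f x +o_ 0 id.
  apply/(@eqaddoP _ _ _ _ (nbhs_filter_on (0 : V))) => e e0.
  have fgh : \forall h \near 0, f (h + x) = g (h + x).
    have /= fg' : \forall y \near x, f y = g y by exact: fg.
    move: fg'; rewrite (near_shift 0) subr0 => fg'.
    near=> h; near: h; exact: fg'.
  move: (fg) => /nbhs_singleton fgx.
  move: dfE => /eqaddoP/(_ e e0); apply: filterS2 fgh => h.
  by rewrite !fctE /= fgx => ->.
apply/diff_locallyP; rewrite (diff_unique dfc key); split => //.
Unshelve. all: by end_near. Qed.

Lemma is_diff_linear V W (L : V -> W) : linear L -> continuous L ->
  forall x, is_diff x L L.
Proof.
move=> Llin Lc x.
pose LM := GRing.isLinear.Build _ _ _ _ _ Llin.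
pose LL : {linear _ -> _} := HB.pack L LM.
have := @linear_differentiable R V W LL x Lc => dL.
by split => //; exact: (@diff_lin R V W LL x Lc).
Qed.

Lemma differentiable_linear V W (L : V -> W) x : linear L -> continuous L ->
  differentiable L x.
Proof. by move=> Llin Lc; have [] := is_diff_linear Llin Lc x. Qed.

Lemma derive_linear V W (L : V -> W) : linear L -> continuous L ->
  forall x v, 'D_v L x = L v.
Proof.
move=> Llin Lc x v; have LD := is_diff_linear Llin Lc x.
by rewrite deriveE // diff_val.
Qed.

Lemma derive_linear_comp V V' W (f : V -> V') (L : V' -> W) x v :
  linear L -> continuous L -> differentiable f x ->
  'D_v (L \o f) x = L ('D_v f x).
Proof.
move=> Llin Lc df; have LD := is_diff_linear Llin Lc (f x).
rewrite !deriveE //; last exact: differentiable_comp.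
by rewrite diff_comp // /= diff_val.
Qed.

(** The two difference quotients are the same function of h, since L (h v + x) = h L v + L x. *)
Lemma derive_comp_linear V V' W (f : V' -> W) (L : V -> V') x v :
  linear L -> 'D_v (f \o L) x = 'D_(L v) f (L x).
Proof.
move=> Llin; rewrite /derive.
set F := (fun h : R => _); set G := (fun h : R => _).
by suff -> : F = G by []; apply/funext => h; rewrite /F /G /= Llin.
Qed.

Lemma derive_comp_rV m V W (f : 'rV[R]_m -> W) (h : V -> 'rV[R]_m) x v :
  differentiable h x -> differentiable f (h x) ->
  'D_v (f \o h) x = \sum_i 'D_v h x 0 i *: 'D_(delta_mx 0 i) f (h x).
Proof.
move=> dh df; rewrite deriveE; last exact: differentiable_comp.
rewrite diff_comp //= -(deriveE _ dh) [in LHS](row_sum_delta ('D_v h x)).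
by rewrite linear_sum; apply: eq_bigr => i _; rewrite linearZ -deriveE.
Qed.

End Differentiability.

Section SmoothFunctions.
Context {R : realType}.
Implicit Types V W : normedModType R.

Lemma diff_on_sub V W k (U U' : set V) (f : V -> W) :
  U' `<=` U -> diff_on k U f -> diff_on k U' f.
Proof.
move=> UU'; elim: k f => //= k IH f [df Df]; split=> [y /UU'|v]; first exact: df.
exact: IH.
Qed.

Lemma smooth_on_sub V W (U U' : set V) (f : V -> W) :
  U' `<=` U -> smooth_on U f -> smooth_on U' f.
Proof. by move=> UU' sf k; apply: diff_on_sub (sf k). Qed.

Lemma diff_onW V W k (U : set V) (f : V -> W) : diff_on k.+1 U f -> diff_on k U f.
Proof. by elim: k f => // k IH f [df Df]; split => // v; apply: IH. Qed.

Lemma diff_on_eq V W k (U : set V) (f g : V -> W) : open U ->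
  (forall y, U y -> f y = g y) -> diff_on k U f -> diff_on k U g.
Proof.
move=> oU; elim: k f g => //= k IH f g fg [df Df].
have nfg y : U y -> {near y, f =1 g}.
  by move=> Uy; near=> z; apply: fg; near: z; exact: open_nbhs_nbhs.
split=> [y Uy|v]; first exact: near_eq_differentiable (nfg y Uy) (df y Uy).
by apply: (IH ('D_v f)) => // y Uy; apply: near_eq_derive; exact: nfg.
Unshelve. all: by end_near. Qed.

Lemma smooth_on_eq V W (U : set V) (f g : V -> W) : open U ->
  (forall y, U y -> f y = g y) -> smooth_on U f -> smooth_on U g.
Proof. by move=> oU fg sf k; apply: diff_on_eq (sf k). Qed.

Lemma smooth_on_differentiable V W (U : set V) (f : V -> W) y :
  smooth_on U f -> U y -> differentiable f y.
Proof. by move=> /(_ 1%N) [+ _] => /[apply]. Qed.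

Lemma smooth_on_derive V W (U : set V) (f : V -> W) v :
  smooth_on U f -> smooth_on U ('D_v f).
Proof. by move=> sf k; have [_] := sf k.+1; exact. Qed.

Lemma smooth_on_locally V W (U : set V) (f : V -> W) :
  (forall y, U y -> exists2 U', open_nbhs y U' & smooth_on U' f) -> smooth_on U f.
Proof.
move=> H k; elim: k f H => //= k IH f H; split.
  by move=> y /H [U' [oU' U'y] sf]; exact: smooth_on_differentiable sf U'y.
move=> v; apply: IH => y /H [U' oU' sf]; exists U' => //.
exact: smooth_on_derive.
Qed.

Lemma smooth_on_cst V W (U : set V) (w : W) : smooth_on U (cst w).
Proof.
move=> k; elim: k w => //= k IH w; split=> [y _|v]; first exact: differentiable_cst.
have -> : 'D_v (cst w) = cst 0 :> (V -> W); last exact: IH.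
by apply/funext => y; rewrite derive_cst.
Qed.

Lemma diff_on_add V W k (U : set V) (f g : V -> W) : open U ->
  diff_on k U f -> diff_on k U g -> diff_on k U (f \+ g).
Proof.
move=> oU; elim: k f g => //= k IH f g [df Df] [dg Dg]; split=> [y Uy|v].
  by apply: differentiableD; [exact: df|exact: dg].
apply: (@diff_on_eq _ _ _ _ ('D_v f \+ 'D_v g)) => //; last exact: IH.
by move=> y Uy; rewrite [RHS]deriveD //; apply: diff_derivable; [exact: df|exact: dg].
Qed.

Lemma smooth_on_add V W (U : set V) (f g : V -> W) : open U ->
  smooth_on U f -> smooth_on U g -> smooth_on U (f \+ g).
Proof. by move=> oU sf sg k; apply: diff_on_add. Qed.

Lemma smooth_on_linear_comp V V' W (U : set V) (f : V -> V') (L : V' -> W) :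
  open U -> linear L -> continuous L -> smooth_on U f -> smooth_on U (L \o f).
Proof.
move=> oU Llin Lc sf k; elim: k f sf => //= k IH f sf.
have df y : U y -> differentiable f y by exact: smooth_on_differentiable.
split=> [y Uy|v].
  apply: differentiable_comp; first exact: df.
  exact: differentiable_linear.
apply: (@diff_on_eq _ _ _ _ (L \o 'D_v f)) => //.
  by move=> y Uy; rewrite derive_linear_comp //; exact: df.
by apply: IH; exact: smooth_on_derive.
Qed.

Lemma smooth_on_comp_linear V V' W (U : set V') (f : V' -> W) (L : V -> V') :
  linear L -> continuous L -> smooth_on U f -> smooth_on (L @^-1` U) (f \o L).
Proof.
move=> Llin Lc sf k; elim: k f sf => //= k IH f sf.
have df y : U y -> differentiable f y by exact: smooth_on_differentiable.
split=> [y Uy|v].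
  apply: differentiable_comp; last exact: df.
  exact: differentiable_linear.
have -> : 'D_v (f \o L) = 'D_(L v) f \o L.
  by apply/funext => y; rewrite derive_comp_linear.
by apply: IH; exact: smooth_on_derive.
Qed.

Lemma smooth_on_linear V W (U : set V) (L : V -> W) :
  linear L -> continuous L -> smooth_on U L.
Proof.
move=> Llin Lc [//|k]; split=> [y _|v].
  exact: differentiable_linear.
have -> : 'D_v L = cst (L v) by apply/funext => y; rewrite derive_linear.
exact: smooth_on_cst.
Qed.

(** Stated at a fixed order k because the inductions of [smooth_on_inv], [smooth_on_comp_rV] and
    [smooth_on_flat_comp] know one of the factors only to that order. *)
Lemma diff_on_mul V k (U : set V) (f g : V -> R) : open U ->
  diff_on k U f -> diff_on k U g -> diff_on k U (f \* g).
Proof.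
move=> oU; elim: k f g => // k IH f g sf sg.
have [df Df] := sf; have [dg Dg] := sg; split=> [y Uy|v].
  by apply: differentiableM; [exact: df|exact: dg].
apply: (@diff_on_eq _ _ _ _ ((f \* 'D_v g) \+ (g \* 'D_v f))) => //.
  by move=> y Uy; rewrite deriveM //; apply: diff_derivable; [exact: df|exact: dg].
apply: diff_on_add => //; first exact: (IH f _ (diff_onW sf) (Dg v)).
exact: (IH g _ (diff_onW sg) (Df v)).
Qed.

Lemma smooth_on_mul V (U : set V) (f g : V -> R) : open U ->
  smooth_on U f -> smooth_on U g -> smooth_on U (f \* g).
Proof. by move=> oU sf sg k; apply: diff_on_mul. Qed.

Lemma smooth_on_scale V W (U : set V) (f : V -> W) (a : R) : open U ->
  smooth_on U f -> smooth_on U (fun y => a *: f y).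
Proof.
move=> oU; apply: (@smooth_on_linear_comp _ _ _ _ _ ( *:%R a)) => //.
  by move=> k u v; rewrite scalerDr !scalerA mulrC.
exact: scaler_continuous.
Qed.

Lemma smooth_on_opp V W (U : set V) (f : V -> W) : open U ->
  smooth_on U f -> smooth_on U (fun y => - f y).
Proof.
move=> oU /(smooth_on_scale (-1) oU).
by apply: smooth_on_eq => // y _; rewrite scaleN1r.
Qed.

Lemma diff_on_sum V W k (U : set V) I (r : seq I) (f : I -> V -> W) :
  open U -> (forall i, diff_on k U (f i)) ->
  diff_on k U (fun y => \sum_(i <- r) f i y).
Proof.
move=> oU sf; elim: r => [|i r IH].
  by apply: diff_on_eq (smooth_on_cst U 0 k) => // y _; rewrite big_nil.
by apply: diff_on_eq (diff_on_add oU (sf i) IH) => // y _; rewrite big_cons.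
Qed.

Lemma smooth_on_sum V W (U : set V) I (r : seq I) (f : I -> V -> W) :
  open U -> (forall i, smooth_on U (f i)) ->
  smooth_on U (fun y => \sum_(i <- r) f i y).
Proof. by move=> oU sf k; apply: diff_on_sum => // i; exact: sf. Qed.

Lemma smooth_on_prod V (U : set V) I (r : seq I) (f : I -> V -> R) :
  open U -> (forall i, smooth_on U (f i)) ->
  smooth_on U (fun y => \prod_(i <- r) f i y).
Proof.
move=> oU sf; elim: r => [|i r IH].
  by apply: smooth_on_eq (smooth_on_cst U (1 : R)) => // y _; rewrite big_nil.
by apply: smooth_on_eq (smooth_on_mul oU (sf i) IH) => // y _; rewrite big_cons.
Qed.

Lemma smooth_on_inv V (U : set V) (f : V -> R) : open U ->
  smooth_on U f -> (forall y, U y -> f y != 0) -> smooth_on U (fun y => (f y)^-1).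
Proof.
move=> oU sf f0 k.
have df y : U y -> differentiable f y by exact: smooth_on_differentiable.
elim: k => //= k IH.
split=> [y Uy|v].
  by apply: differentiableV; [exact: df|exact: f0].
pose F y := (f y)^-1.
apply: (@diff_on_eq _ _ _ _ ((fun y => - 'D_v f y) \* (F \* F))) => //.
  move=> y Uy; rewrite deriveV; [|exact: f0|exact/diff_derivable/df].
  by rewrite /= /F mulNr -expr2 -exprVn mulrC scaleNr.
apply: diff_on_mul => //; last exact: diff_on_mul.
exact/smooth_on_opp/smooth_on_derive.
Qed.

Lemma smooth_on_mx V (U : set V) m p (f : V -> 'M[R]_(m, p)) : open U ->
  (forall i j, smooth_on U (fun y => f y i j)) -> smooth_on U f.
Proof.
move=> oU sf.
apply: (@smooth_on_eq _ _ _ (fun y => \sum_i \sum_j f y i j *: delta_mx i j)) => //.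
  by move=> y _; rewrite -matrix_sum_delta.
apply: smooth_on_sum => // i; apply: smooth_on_sum => // j.
apply: (@smooth_on_linear_comp _ _ _ _ (fun y => f y i j) ( *:%R ^~ (delta_mx i j))) => //.
  by move=> a u v; rewrite scalerDl scalerA.
exact: scalel_continuous.
Qed.

Lemma smooth_on_entry V (U : set V) m p (f : V -> 'M[R]_(m, p)) i j : open U ->
  smooth_on U f -> smooth_on U (fun y => f y i j).
Proof.
move=> oU; apply: (@smooth_on_linear_comp _ _ _ _ _ (fun A : 'M[R]_(m, p) => A i j)) => //.
  by move=> a u v; rewrite !mxE.
exact: coord_continuous.
Qed.

Lemma smooth_on_mulmx V (U : set V) m p q (f : V -> 'M[R]_(m, p))
  (h : V -> 'M[R]_(p, q)) : open U ->
  smooth_on U f -> smooth_on U h -> smooth_on U (fun y => f y *m h y).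
Proof.
move=> oU sf sh; apply: smooth_on_mx => // i j.
apply: (@smooth_on_eq _ _ _ (fun y => \sum_k f y i k * h y k j)) => //.
  by move=> y _; rewrite mxE.
apply: smooth_on_sum => // k; apply: smooth_on_mul => //; exact: smooth_on_entry.
Qed.

Lemma smooth_on_det V (U : set V) m (f : V -> 'M[R]_m) : open U ->
  (forall i j, smooth_on U (fun y => f y i j)) -> smooth_on U (fun y => \det (f y)).
Proof.
move=> oU sf; apply: smooth_on_sum => // s; apply: smooth_on_scale => //.
exact: smooth_on_prod.
Qed.

(** By Cramer's formula the entries of the inverse are cofactors divided by the determinant. *)
Lemma smooth_on_invmx V (U : set V) m (f : V -> 'M[R]_m) : open U ->
  (forall y, U y -> f y \in unitmx) ->
  smooth_on U f -> smooth_on U (fun y => invmx (f y)).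
Proof.
move=> oU fU sf; apply: smooth_on_mx => // i j.
have se k l : smooth_on U (fun y => f y k l) by exact: smooth_on_entry.
apply: (@smooth_on_eq _ _ _ (fun y => (\det (f y))^-1 * cofactor (f y) j i)) => //.
  by move=> y Uy; rewrite /invmx fU // !mxE.
apply: smooth_on_mul => //.
  apply: smooth_on_inv => //; first exact: smooth_on_det.
  by move=> y /fU; rewrite unitmxE unitfE.
apply: smooth_on_scale => //; apply: smooth_on_det => // k l.
by apply: smooth_on_eq (se (lift j k) (lift i l)) => // y _; rewrite !mxE.
Qed.

(** With a coordinate space in the middle, the chain rule is a finite sum of products. The induction
    varies f and fixes h: the partial derivatives of f occur again composed with h. *)
Lemma smooth_on_comp_rV m V (U : set V) (U' : set 'rV[R]_m) (f : 'rV[R]_m -> R)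
  (h : V -> 'rV[R]_m) : open U -> (forall y, U y -> U' (h y)) ->
  smooth_on U' f -> smooth_on U h -> smooth_on U (f \o h).
Proof.
move=> oU UU' sf sh k; elim: k f sf => // k IH f sf.
have df y : U y -> differentiable f (h y).
  by move=> /UU'; exact: smooth_on_differentiable.
have dh y : U y -> differentiable h y by exact: smooth_on_differentiable.
split=> [y Uy|v]; first by apply: differentiable_comp; [exact: dh|exact: df].
apply: (@diff_on_eq _ _ _ _
    (fun y => \sum_i 'D_v h y 0 i * 'D_(delta_mx 0 i) f (h y))) => //.
  by move=> y Uy; rewrite derive_comp_rV //; [exact: dh|exact: df].
apply: diff_on_sum => // i.
apply: (@diff_on_mul _ _ _ (fun y => 'D_v h y 0 i)) => //.
  by apply: smooth_on_entry => //; exact: smooth_on_derive.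
exact: (IH ('D_(delta_mx 0 i) f) (smooth_on_derive _ sf)).
Qed.

Lemma smooth_on_comp_mx m p q V (U : set V) (U' : set 'rV[R]_m)
  (f : 'rV[R]_m -> 'M[R]_(p, q)) (h : V -> 'rV[R]_m) :
  open U -> open U' -> (forall y, U y -> U' (h y)) ->
  smooth_on U' f -> smooth_on U h -> smooth_on U (f \o h).
Proof.
move=> oU oU' UU' sf sh; apply: smooth_on_mx => // i j.
exact: (smooth_on_comp_rV oU UU' (smooth_on_entry i j oU' sf) sh).
Qed.

Lemma smooth_on_jacobian m p (U : set 'rV[R]_m) (f : 'rV[R]_m -> 'rV[R]_p) :
  open U -> smooth_on U f -> smooth_on U (jacobian f).
Proof.
move=> oU sf; apply: smooth_on_mx => // i j.
apply: (@smooth_on_eq _ _ _ (fun y => 'D_(delta_mx 0 i) f y 0 j)) => //.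
  move=> y Uy; rewrite deriveEjacobian; last exact: smooth_on_differentiable Uy.
  by rewrite -rowE mxE.
by apply: smooth_on_entry => //; exact: smooth_on_derive.
Qed.

End SmoothFunctions.

(** * Symmetry of second derivatives *)

Section Schwarz.
Context {R : realType} {V : normedModType R}.

Lemma derive_line (W : normedModType R) (f : V -> W) (w u : V) (s : R) :
  'D_u f (w + s *: u) = 'D_1 (fun s : R => f (w + s *: u)) s.
Proof.
rewrite /derive.
set F := (fun h : R => h^-1 *: _); set G := (fun h : R => h^-1 *: _).
suff -> : F = G by [].
apply/funext => h; rewrite /F /G /= -[h *: 1]/(h * 1) mulr1.
by rewrite scalerDl addrCA.
Qed.

Lemma is_derive_line (f : V -> R) (w u : V) (s : R) :
  differentiable f (w + s *: u) ->
  is_derive s 1 (fun s => f (w + s *: u)) ('D_u f (w + s *: u)).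
Proof.
move=> df; split.
  have dl : differentiable (cst w + ( *:%R^~ u : R -> V)) s by exact: differentiableD.
  exact: diff_derivable (differentiable_comp dl df).
by rewrite (derive_line f).
Qed.

(* mean value theorem along [u], then differentiability of ['D_u f] at [y] *)
Lemma second_difference (f : V -> R) (y u v : V) (e : R) :
  (\forall z \near y, differentiable f z) -> differentiable ('D_u f) y -> 0 < e ->
  \forall h \near 0^'+, `|f (y + h *: u + h *: v) - f (y + h *: u)
      - f (y + h *: v) + f y - h ^+ 2 * 'D_v ('D_u f) y| <= e * h ^+ 2.
Proof.
set g := 'D_u f => nf dg e0.
(* h K bounds |a u + b v| for 0 <= a, b <= h. The 2 in d pays for two expansions of g at y, towards
   s u and towards s u + h v. *)
pose K := `|u| + `|v| + 1.
have K0 : 0 < K by rewrite ltr_wpDl // addr_ge0.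
pose d := e / (2 * K).
have d0 : 0 < d by rewrite divr_gt0 // mulr_gt0.
have [r r0 Hf] : exists2 r : R, 0 < r & forall k, `|k| < r -> differentiable f (y + k).
  have /nbhs_ballP[r /= r0 H] := nf; exists r => // k kr; apply: H.
  by rewrite -ball_normE /= opprD addNKr normrN.
have [r' r'0 Hg] : exists2 r : R, 0 < r & forall k, `|k| < r ->
    `|g (y + k) - g y - 'd g y k| <= d * `|k|.
  have := diff_locally dg => /eqaddoP /(_ d d0) /nbhs_ballP[r' /= r'0 H].
  exists r' => // k kr; have := H k; rewrite -ball_normE /= sub0r normrN => /(_ kr).
  by rewrite !fctE /= opprD addrA [k + y]addrC.
near=> h.
have h0 : 0 < h by near: h; exact: nbhs_right_gt.
have hr : h * K < r by rewrite -ltr_pdivlMr //; near: h; apply: nbhs_right_lt; exact: divr_gt0.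
have hr' : h * K < r' by rewrite -ltr_pdivlMr //; near: h; apply: nbhs_right_lt; exact: divr_gt0.
have bnd (a b : R) : 0 <= a <= h -> 0 <= b <= h -> `|a *: u + b *: v| <= h * K.
  move=> /andP[a0 ah] /andP[b0 bh]; apply: le_trans (ler_normD _ _) _.
  rewrite !normrZ !ger0_norm // /K !mulrDr mulr1 -[leLHS]addr0 lerD // ?(ltW h0) //.
  by rewrite lerD // ler_wpM2r.
have bndu (a : R) : 0 <= a <= h -> `|a *: u| <= h * K.
  by move=> a0; have := bnd a 0 a0; rewrite scale0r addr0; apply; rewrite lexx ltW.
pose phi s := f (y + h *: v + s *: u) - f (y + s *: u).
have dphi s : s \in `[0, h] -> is_derive s 1 phi (g (y + h *: v + s *: u) - g (y + s *: u)).
  rewrite in_itv => s0h; apply: is_deriveB.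
    apply: is_derive_line; rewrite -addrA; apply: Hf; rewrite addrC.
    by apply: le_lt_trans hr; apply: bnd => //; rewrite lexx ltW.
  apply: is_derive_line; apply: Hf.
  by apply: le_lt_trans hr; apply: bndu.
pose dphi' s := g (y + h *: v + s *: u) - g (y + s *: u).
have ddphi s : s \in `]0, h[ -> is_derive s 1 phi (dphi' s).
  by move=> s0h; apply: dphi; move: s0h; rewrite !in_itv /= => /andP[/ltW -> /ltW ->].
have cphi : {within `[0, h], continuous phi}.
  by apply: derivable_within_continuous => s sh; have [] := dphi s sh.
have [s s0h] := @MVT R phi dphi' 0 h h0 ddphi cphi.
rewrite /dphi'.
have sh : 0 <= s <= h by move: s0h; rewrite in_itv /= => /andP[/ltW -> /ltW ->].
rewrite subr0 /phi scale0r !addr0 => E.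
have -> : f (y + h *: u + h *: v) - f (y + h *: u) - f (y + h *: v) + f y =
    (g (y + h *: v + s *: u) - g (y + s *: u)) * h.
  by rewrite -E [y + h *: u + _]addrAC; ring.
have hh : 0 <= h <= h by rewrite lexx ltW.
have := Hg (s *: u + h *: v) (le_lt_trans (bnd _ _ sh hh) hr').
have := Hg (s *: u) (le_lt_trans (bndu _ sh) hr').
rewrite (deriveE _ dg) linearD [X in h ^+ 2 * X]/= -/g.
have -> : y + h *: v + s *: u = y + (s *: u + h *: v) by rewrite -addrA [h *: v + _]addrC.
rewrite [in 'd g y (h *: v)]linearZ.
set A := g (y + s *: u); set B := g (y + (s *: u + h *: v)).
set a := 'd g y (s *: u); set b := 'd g y v.
move=> H1 H2.
have H1' := le_trans H1 (ler_wpM2l (ltW d0) (bndu _ sh)).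
have H2' := le_trans H2 (ler_wpM2l (ltW d0) (bnd _ _ sh hh)).
(* The unknown mean value s occurs only in the linear term a, which cancels. *)
have -> : (B - A) * h - h ^+ 2 * b = h * ((B - g y - (a + h *: b)) - (A - g y - a)).
  rewrite -[h *: b]/(h * b); ring.
rewrite normrM (gtr0_norm h0) expr2 mulrCA ler_pM2l //.
apply: le_trans (ler_normB _ _) _; apply: le_trans (lerD H2' H1') _.
rewrite le_eqVlt; apply/orP; left; apply/eqP; rewrite /d; field.
by rewrite gt_eqF.
Unshelve. all: by end_near. Qed.

(** The second difference is symmetric in u and v, and by [second_difference] both mixed derivatives
    times h^2 approximate it up to e h^2 / 2. So they differ by at most e, for every e. *)
Lemma derive_comm (f : V -> R) (y u v : V) :
  (\forall z \near y, differentiable f z) -> differentiable ('D_u f) y ->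
  differentiable ('D_v f) y -> 'D_v ('D_u f) y = 'D_u ('D_v f) y.
Proof.
move=> nf du dv; apply/eqP; rewrite -subr_eq0 -normr_le0; apply/ler_addgt0Pl => e e0.
rewrite addr0.
have e2 : 0 < e / 2 by rewrite divr_gt0.
have SD1 := second_difference v nf du e2.
have SD2 := second_difference u nf dv e2.
have h_gt0 : \forall h \near 0^'+, 0 < (h : R) by exact: nbhs_right_gt.
have [h [[h0 H2] H1]] : exists h : R, (_ /\ _) /\ _ :=
  @filter_ex R (at_right 0) _ _ (filterI (filterI h_gt0 SD1) SD2).
move: H1 H2; rewrite [y + h *: v + _]addrAC.
set A := 'D_v ('D_u f) y; set B := 'D_u ('D_v f) y.
set D1 := f (_ + _ + _); set D2 := f (y + h *: u); set D3 := f (y + h *: v) => H1 H2.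
have h2 : 0 < h ^+ 2 by rewrite exprn_gt0.
rewrite -(ler_pM2l h2) -[X in X * _](gtr0_norm h2) -normrM.
have -> : h ^+ 2 * (A - B) = (D1 - D3 - D2 + f y - h ^+ 2 * B) - (D1 - D2 - D3 + f y - h ^+ 2 * A).
  ring.
apply: le_trans (ler_normB _ _) _; apply: le_trans (lerD H1 H2) _.
by rewrite -mulrDl -splitr mulrC.
Qed.
End Schwarz.

(** * Bump functions *)

Section Bump.
Context {R : realType}.

(* [p(1/s) exp(-1/s)] for [s > 0]: with p ranging over all polynomials, this
   family is stable under derivation, which makes smoothness an induction. *)
Definition flat (p : {poly R}) (s : R) : R :=
  if 0 < s then p.[s^-1] * expR (- s^-1) else 0.

Lemma expR_poly_bounded (p : {poly R}) :
  exists C : R, forall x, 0 <= x -> `|p.[x] * expR (- x)| <= C.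
Proof.
(* Coefficient by coefficient, from x^i <= i! exp x. *)
exists (\sum_(i < size p) `|p`_i| * (i`!)%:R) => x x0.
rewrite horner_coef mulr_suml; apply: le_trans (ler_norm_sum _ _ _) _.
apply: ler_sum => i _; rewrite -mulrA normrM ler_wpM2l //.
rewrite ger0_norm ?mulr_ge0 ?exprn_ge0 ?expR_ge0 // expRN ler_pdivrMr ?expR_gt0 //.
case: (i : nat) => [|j].
  by rewrite expr0 mul1r -expR0 ler_expR.
rewrite -ler_pdivrMl ?ltr0n ?fact_gt0 // mulrC.
by apply: le_trans (expR_ge1Dxn j x0); rewrite lerDr.
Qed.

(** For s > 0 one has p(1/s) = s (p 'X)(1/s), and the polynomial [p * 'X] obeys
    [expR_poly_bounded]. *)
Lemma flat_small (p : {poly R}) : exists C : R, forall s, `|flat p s| <= C * `|s|.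
Proof.
have [C HC] := expR_poly_bounded (p * 'X).
have C0 : 0 <= C by apply: le_trans (HC 0 (lexx _)).
exists C => s; rewrite /flat; case: ltP => s0; last by rewrite normr0 mulr_ge0.
have si : 0 <= s^-1 by rewrite invr_ge0 ltW.
have := HC _ si; rewrite hornerMX (gtr0_norm s0) -ler_pdivrMr // mulrAC normrM.
by rewrite (ger0_norm si).
Qed.

(** In the variable X = 1/s the derivation d/ds is - X^2 d/dX, which takes p exp(-X) to X^2 (p - p')
    exp(-X). At 0 the difference quotient is [flat (p * 'X)], which tends to 0 by [flat_small]. *)
Lemma is_derive_flat (p : {poly R}) (s : R) :
  is_derive s 1 (flat p) (flat ('X^2 * (p - p^`())) s).
Proof.
have [s0|s0|<-] := ltgtP 0 s.
- have sn0 : s != 0 by rewrite gt_eqF.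
  have dinv : is_derive s 1 (fun x : R => x^-1) (- s ^- 2).
    split; first by apply: (@derivableV _ _ id).
    by rewrite (@deriveV _ _ id) // derive_id -[_ *: _]/(_ * _) mulr1 .
  have d1 := is_derive1_comp (is_derive_poly p s^-1) dinv.
  have d2 := @is_derive1_comp _ expR (- (fun x : R => x^-1)) s _ _
    (is_derive_expR _) (is_deriveN dinv).
  pose F (x : R) : R := p.[x^-1] * expR (- x^-1).
  have d3 : is_derive s 1 F (flat ('X^2 * (p - p^`())) s).
    apply: (is_derive_eq (is_deriveM d1 d2)).
    by rewrite /flat s0 /= hornerM hornerXn hornerD hornerN -![_ *: _]/(_ * _) exprVn; ring.
  apply: near_eq_is_derive d3.
  by near=> x; rewrite /F /flat ifT //; near: x; exact: lt_nbhsr.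
- rewrite {2}/flat ltNge (ltW s0) /=.
  have dZ : is_derive s 1 (fun=> 0 : R) (0 : R) by exact: is_derive_cst.
  apply: near_eq_is_derive dZ.
  near=> x; rewrite /flat ifF //; apply/negbTE; rewrite -leNgt ltW //.
  near: x; exact: lt_nbhsl.
rewrite {2}/flat ltxx.
have [C HC] := flat_small (p * 'X).
suff H : (fun h => h^-1 *: ((flat p \o shift 0) (h *: 1) - flat p 0)) @ 0^' --> (0 : R).
  by split; [apply/cvg_ex; exists 0|apply: cvg_lim].
have C0 : 0 <= C.
  by have := HC 1; rewrite normr1 mulr1; exact: le_trans.
apply/cvgrPdist_le => e e0; near=> h.
have h0 : h != 0 by near: h; exact: nbhs_dnbhs_neq.
rewrite sub0r normrN /= addr0 -[h *: 1]/(h * 1) mulr1 [flat p 0]/flat ltxx subr0.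
have -> : h^-1 *: flat p h = flat (p * 'X) h.
  rewrite /flat; case: ltP => _; last by rewrite scaler0.
  by rewrite hornerMX -[_ *: _]/(_ * _) mulrA [h^-1 * _]mulrC.
apply: le_trans (HC h) _.
(* C may be 0, hence the division by C + 1. *)
have hC : `|h| < e / (C + 1).
  near: h; apply: dnbhs0_lt; rewrite divr_gt0 //; lra.
apply: (@le_trans _ _ ((C + 1) * `|h|)); first by rewrite ler_wpM2r // lerDl.
by rewrite mulrC -ler_pdivlMr ?ltW //; lra.
Unshelve. all: by end_near. Qed.

Lemma smooth_on_flat_comp (V : normedModType R) (s : V -> R) (p : {poly R}) :
  smooth_on setT s -> smooth_on setT (flat p \o s).
Proof.
move=> ss k; elim: k p => // k IH p.
have ds y : differentiable s y by exact: smooth_on_differentiable ss _.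
have df q x : differentiable (flat q) x.
  by apply/derivable1_diffP; have [] := is_derive_flat q x.
split=> [y _|v]; first exact: differentiable_comp.
set q := 'X^2 * (p - p^`()).
apply: (@diff_on_eq _ _ _ _ _ ('D_v s \* (flat q \o s))); first exact: openT.
  move=> y _; rewrite deriveE; last exact: differentiable_comp.
  rewrite diff_comp //= -(deriveE _ (ds y)) deriv1E; last exact/derivable1_diffP.
  by rewrite derive1E; have [_ ->] := is_derive_flat p (s y).
by apply: diff_on_mul => //; [exact: openT | exact: (smooth_on_derive v ss k)].
Qed.

(** The function s is r^2 minus the squared Euclidean distance to c, which is smooth, while the norm
    on row vectors is the sup norm; the Euclidean ball lies in the sup ball of the same radius. *)
Lemma smooth_bump n (c : 'rV[R]_n) (r : R) : 0 < r ->
  exists2 phi : 'rV[R]_n -> R, smooth_on setT phi /\ phi c != 0 &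
    forall y, phi y != 0 -> `|y - c| < r.
Proof.
move=> r0; pose s (y : 'rV[R]_n) := r ^+ 2 - \sum_i (y 0 i - c 0 i) ^+ 2.
exists (flat 1%:P \o s); first split.
- apply: smooth_on_flat_comp.
  have oT := @openT 'rV[R]_n.
  apply: (@smooth_on_add _ _ _ _ (cst (r ^+ 2))) => //; first exact: smooth_on_cst.
  apply: smooth_on_opp => //; apply: smooth_on_sum => // i.
  have si : smooth_on setT (fun y : 'rV[R]_n => y 0 i - c 0 i).
    apply: (@smooth_on_add _ _ _ _ _ (cst (- c 0 i))) => //; last exact: smooth_on_cst.
    apply: smooth_on_linear; first by move=> a u v; rewrite !mxE.
    exact: coord_continuous.
  exact: (smooth_on_mul oT si si).
- rewrite /= /flat /s big1; last by move=> i _; rewrite subrr expr0n.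
  by rewrite subr0 exprn_gt0 // hornerC mul1r gt_eqF ?expR_gt0.
move=> y; rewrite /= /flat; case: ltP => [|_]; last by rewrite eqxx.
rewrite subr_gt0 => H _.
rewrite /Num.Def.normr /= mx_normrE; apply/bigmax_ltP; split=> // -[a i] _ /=.
rewrite (ord1 a) !mxE -[_ < _](@ltr_pXn2r _ 2) ?nnegrE ?(ltW r0) //.
rewrite real_normK ?num_real //; apply: le_lt_trans H.
by rewrite (bigD1 i) //= lerDl sumr_ge0 // => j _; exact: sqr_ge0.
Qed.

End Bump.

Lemma riemann_antisym (R : realType) n (G : 'rV[R]_n -> 'M[R]_n) l k i j y :
  riemann G l k i j y = - riemann G l k j i y.
Proof.
rewrite /riemann opprD opprB -sumrN; congr (_ + _).
by apply: eq_bigr => m _; rewrite opprB.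
Qed.

(** * Symmetries of the Riemann tensor *)

(** One summand of [lowered_riemannE]: the sums [li + mi] and [lj + mj] are the derivatives of a
    metric entry given by [metric_compatible]. *)
Lemma curvature_algebra (F : comNzRingType) (g a b li mi cj lj mj ck : F) :
  g * a - g * b + (li * cj - lj * ck) =
  g * a + (li + mi) * cj - (g * b + (lj + mj) * ck) - (mi * cj - mj * ck).
Proof. by ring. Qed.

(** In [lowered_riemann_antisym], d is a mixed second derivative of a metric entry, reached in
    either order, while s and t are the quadratic terms. *)
Lemma antisym_algebra (F : comNzRingType) (a1 a2 b1 b2 s t d : F) :
  a1 + a2 = d -> b1 + b2 = d -> a1 - b1 - (s - t) + (a2 - b2 - (t - s)) = 0.
Proof.
move=> <- /eqP; rewrite -subr_eq0 => /eqP E.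
have -> : a1 - b1 - (s - t) + (a2 - b2 - (t - s)) = - (b1 + b2 - (a1 + a2)) by ring.
by rewrite E oppr0.
Qed.

(** The adjugate formula for a left inverse x of a symmetric 2 by 2 matrix, in scalars so that
    [ring] and [field] apply. *)
Lemma inverse_sym2 (F : fieldType) (x00 x01 x10 x11 g00 g01 g11 : F) :
  x00 * g00 + x01 * g01 = 1 -> x00 * g01 + x01 * g11 = 0 ->
  x10 * g00 + x11 * g01 = 0 -> x10 * g01 + x11 * g11 = 1 ->
  let D := g00 * g11 - g01 ^+ 2 in
  D != 0 /\ [/\ x00 = g11 / D, x01 = - g01 / D, x10 = - g01 / D & x11 = g00 / D].
Proof.
move=> e0 e1 e2 e3 D.
have h00 : x00 * D = g11.
  transitivity (g11 * (x00 * g00 + x01 * g01) - g01 * (x00 * g01 + x01 * g11)).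
    by rewrite /D; ring.
  by rewrite e0 e1; ring.
have h01 : x01 * D = - g01.
  transitivity (g00 * (x00 * g01 + x01 * g11) - g01 * (x00 * g00 + x01 * g01)).
    by rewrite /D; ring.
  by rewrite e0 e1; ring.
have h10 : x10 * D = - g01.
  transitivity (g11 * (x10 * g00 + x11 * g01) - g01 * (x10 * g01 + x11 * g11)).
    by rewrite /D; ring.
  by rewrite e2 e3; ring.
have h11 : x11 * D = g00.
  transitivity (g00 * (x10 * g01 + x11 * g11) - g01 * (x10 * g00 + x11 * g01)).
    by rewrite /D; ring.
  by rewrite e2 e3; ring.
have D0 : D != 0.
  apply/eqP => D0; move: e0; rewrite -h11 D0 mulr0 mulr0 add0r.
  have : g01 = 0 by apply/eqP; rewrite -oppr_eq0 -h01 D0 mulr0.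
  by move=> ->; rewrite mulr0 => /esym/eqP; rewrite oner_eq0.
by split=> //; split; apply: (canRL (mulfK D0)).
Qed.

(** * Curvature depends only on the germ of the metric *)

Section Locality.
Context {R : realType} {n : nat}.
Implicit Types (f g : 'rV[R]_n -> R) (G : 'rV[R]_n -> 'M[R]_n) (U : set 'rV[R]_n).

Lemma pderiv_eq U i f g y : open U -> U y -> (forall z, U z -> f z = g z) ->
  pderiv i f y = pderiv i g y.
Proof.
move=> oU Uy fg; apply: near_eq_derive; near=> z; apply: fg; near: z.
exact: open_nbhs_nbhs.
Unshelve. all: by end_near. Qed.

Lemma christoffel_eq U G G' k i j y : open U -> U y ->
  (forall z, U z -> G z = G' z) -> christoffel G k i j y = christoffel G' k i j y.
Proof.
move=> oU Uy GG; have pE a b c : pderiv a (fun z => G z b c) y = pderiv a (fun z => G' z b c) y.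
  by apply: (pderiv_eq a oU) => // z Uz; rewrite GG.
by rewrite /christoffel GG //; under eq_bigr do rewrite !pE.
Qed.

Lemma ricci_mx_eq U G G' y : open U -> U y ->
  (forall z, U z -> G z = G' z) -> ricci_mx G y = ricci_mx G' y.
Proof.
move=> oU Uy GG; have cE a b c z : U z -> christoffel G a b c z = christoffel G' a b c z.
  by move=> Uz; exact: christoffel_eq GG.
apply/matrixP => j k; rewrite !mxE; apply: eq_bigr => i _; rewrite /riemann.
rewrite !(pderiv_eq _ oU Uy (cE _ _ _)); congr (_ + _).
by apply: eq_bigr => m _; rewrite !cE.
Qed.

End Locality.

Section CurvatureSymmetries.
Context {R : realType} {n : nat} (G : 'rV[R]_n -> 'M[R]_n).
Variable U : set 'rV[R]_n.
Hypothesis oU : open U.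
Hypothesis sG : smooth_on U G.
Hypothesis G_sym : forall z, U z -> (G z)^T = G z.
Hypothesis G_unit : forall z, U z -> G z \in unitmx.

(* Christoffel symbols of the first kind, Gamma_{l,ij} *)
Definition christoffel1 (l i j : 'I_n) (y : 'rV[R]_n) : R :=
  2^-1 * (pderiv i (fun z => G z j l) y + pderiv j (fun z => G z i l) y
    - pderiv l (fun z => G z i j) y).

Let smooth_G i j : smooth_on U (fun z => G z i j).
Proof. exact: smooth_on_entry. Qed.

Let near_pderiv (f g : 'rV[R]_n -> R) i y : U y ->
  (forall z, U z -> f z = g z) -> pderiv i f y = pderiv i g y.
Proof. exact: pderiv_eq. Qed.

Lemma smooth_on_christoffel1 l i j : smooth_on U (christoffel1 l i j).
Proof.
have sd a b c : smooth_on U (pderiv a (fun z => G z b c)) by exact: smooth_on_derive.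
apply: smooth_on_scale => //; apply: smooth_on_add => //; last exact: smooth_on_opp.
exact: smooth_on_add.
Qed.

Lemma christoffelE k i j y :
  christoffel G k i j y = \sum_l invmx (G y) k l * christoffel1 l i j y.
Proof.
by rewrite /christoffel mulr_sumr; apply: eq_bigr => l _; rewrite mulrCA.
Qed.

Lemma smooth_on_christoffel k i j : smooth_on U (christoffel G k i j).
Proof.
apply: (smooth_on_eq oU) => [y _|]; first by rewrite christoffelE.
apply: smooth_on_sum => // l; apply: smooth_on_mul => //.
  by apply: smooth_on_entry => //; exact: smooth_on_invmx.
exact: smooth_on_christoffel1.
Qed.

Lemma lower_christoffel l i j y : U y ->
  \sum_k G y l k * christoffel G k i j y = christoffel1 l i j y.
Proof.
move=> Uy; under eq_bigr do rewrite christoffelE mulr_sumr.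
rewrite exchange_big /= (bigD1 l) //= [X in _ + X]big1 ?addr0 => [|m ml].
  under eq_bigr do rewrite mulrA.
  rewrite -mulr_suml; have := mulmxV (G_unit Uy) => /matrixP/(_ l l).
  by rewrite !mxE eqxx => ->; rewrite mul1r.
under eq_bigr do rewrite mulrA.
rewrite -mulr_suml; have := mulmxV (G_unit Uy) => /matrixP/(_ l m).
by rewrite !mxE eq_sym (negbTE ml) => ->; rewrite mul0r.
Qed.

Lemma G_symE y l m : U y -> G y l m = G y m l.
Proof. by move=> /G_sym/matrixP/(_ m l); rewrite mxE. Qed.

(** The coordinate form of the fact that the Levi-Civita connection preserves the metric. *)
Lemma metric_compatible i l m y : U y ->
  pderiv i (fun z => G z l m) y = christoffel1 l i m y + christoffel1 m i l y.
Proof.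
move=> Uy; rewrite /christoffel1.
rewrite (@near_pderiv (fun z => G z m l) (fun z => G z l m)) //; last first.
  by move=> z Uz; rewrite G_symE.
by field.
Qed.

(** The covariant curvature G(R(d_i, d_j) d_k, d_l). *)
Definition lowered_riemann l k i j y : R := \sum_m G y l m * riemann G m k i j y.

(** Lowering the index inside a derivative of Gamma costs a derivative of G. By [metric_compatible]
    this is a sum of two first-kind symbols; one cancels the lowered quadratic part of the
    curvature, the other is what remains. *)
Lemma lowered_riemannE l k i j y : U y ->
  lowered_riemann l k i j y =
  pderiv i (christoffel1 l j k) y - pderiv j (christoffel1 l i k) y
  - \sum_m (christoffel1 m i l y * christoffel G m j k y
            - christoffel1 m j l y * christoffel G m i k y).
Proof.
move=> Uy.
have leibniz a b : pderiv a (christoffel1 l b k) y =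
    \sum_m (G y l m * pderiv a (christoffel G m b k) y
            + (christoffel1 l a m y + christoffel1 m a l y) * christoffel G m b k y).
  rewrite -(@near_pderiv (fun z => \sum_m G z l m * christoffel G m b k z)) //; last first.
    by move=> z Uz; rewrite lower_christoffel.
  have dG p q : derivable (fun z => G z p q) y (delta_mx 0 a).
    exact/diff_derivable/(smooth_on_differentiable (smooth_G p q)).
  have dC m : derivable (christoffel G m b k) y (delta_mx 0 a).
    exact/diff_derivable/(smooth_on_differentiable (smooth_on_christoffel m b k)).
  rewrite /pderiv -fct_sumE derive_sum; last by move=> m; exact: derivableM.
  apply: eq_bigr => m _; rewrite deriveM // -/(pderiv a _ y) -/(pderiv a _ y).
  by rewrite metric_compatible // -![_ *: _]/(_ * _) [X in _ + X]mulrC.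
rewrite !leibniz /lowered_riemann /riemann.
have quad (a c d : 'I_n) : \sum_m G y l m * (\sum_p christoffel G m a p y * christoffel G p c d y) =
    \sum_p christoffel1 l a p y * christoffel G p c d y.
  under eq_bigr do rewrite mulr_sumr.
  rewrite exchange_big; apply: eq_bigr => p _.
  by rewrite -(lower_christoffel l a p Uy) mulr_suml; apply: eq_bigr => m _; rewrite mulrA.
transitivity (\sum_m (G y l m * pderiv i (christoffel G m j k) y)
  - \sum_m (G y l m * pderiv j (christoffel G m i k) y)
  + (\sum_p christoffel1 l i p y * christoffel G p j k y
     - \sum_p christoffel1 l j p y * christoffel G p i k y)).
  rewrite -(quad i j k) -(quad j i k) -!sumrB -big_split /=.
  by apply: eq_bigr => m _; rewrite sumrB mulrDr !mulrBr.
rewrite -!sumrB -big_split /=; apply: eq_bigr => m _; exact: curvature_algebra.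
Qed.

(** When the two sides are added, the derivatives of first-kind symbols combine into the commutator
    of d_i and d_j on G_lk, which is 0. The quadratic terms cancel because S is symmetric under
    exchange of its two index pairs, being their product under G. *)
Lemma lowered_riemann_antisym l k i j y : U y ->
  lowered_riemann l k i j y = - lowered_riemann k l i j y.
Proof.
move=> Uy; apply/eqP; rewrite -subr_eq0 opprK !lowered_riemannE //.
pose S a b c d := \sum_m christoffel1 m a b y * christoffel G m c d y.
have SC a b c d : S a b c d = S c d a b.
  have SE p q r s : S p q r s =
      \sum_m \sum_t G y m t * christoffel G t p q y * christoffel G m r s y.
    by apply: eq_bigr => m _; rewrite -(lower_christoffel m p q Uy) mulr_suml.
  rewrite !SE exchange_big; apply: eq_bigr => m _; apply: eq_bigr => t _.
  by rewrite (G_symE _ _ Uy) mulrAC.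
have dd a b : pderiv a (christoffel1 l b k) y + pderiv a (christoffel1 k b l) y =
    pderiv a (pderiv b (fun z => G z l k)) y.
  have dC p q r : derivable (christoffel1 p q r) y (delta_mx 0 a).
    exact/diff_derivable/(smooth_on_differentiable (smooth_on_christoffel1 p q r)).
  rewrite /pderiv -deriveD //; apply: near_pderiv => // z Uz.
  by rewrite [RHS]metric_compatible.
have comm : pderiv i (pderiv j (fun z => G z l k)) y = pderiv j (pderiv i (fun z => G z l k)) y.
  apply: derive_comm.
  - near=> z; apply: (smooth_on_differentiable (smooth_G l k)); near: z.
    exact: open_nbhs_nbhs.
  - exact: (smooth_on_differentiable (smooth_on_derive _ (smooth_G l k))).
  - exact: (smooth_on_differentiable (smooth_on_derive _ (smooth_G l k))).
move: (dd i j) (dd j i); rewrite -comm !sumrB => d1 d2.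
rewrite -![\sum_m christoffel1 m _ _ y * _]/(S _ _ _ _).
rewrite (SC i k j l) (SC j k i l).
by rewrite (antisym_algebra _ _ d1 d2).
Unshelve. all: by end_near. Qed.

Lemma raise_riemann l k i j y : U y ->
  riemann G l k i j y = \sum_m invmx (G y) l m * lowered_riemann m k i j y.
Proof.
move=> Uy; under eq_bigr do rewrite mulr_sumr.
rewrite exchange_big /= (bigD1 l) //= [X in _ + X]big1 ?addr0 => [|m ml].
  under eq_bigr do rewrite mulrA.
  rewrite -mulr_suml; have := mulVmx (G_unit Uy) => /matrixP/(_ l l).
  by rewrite !mxE eqxx => ->; rewrite mul1r.
under eq_bigr do rewrite mulrA.
rewrite -mulr_suml; have := mulVmx (G_unit Uy) => /matrixP/(_ l m).
by rewrite !mxE eq_sym (negbTE ml) => ->; rewrite mul0r.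
Qed.

End CurvatureSymmetries.

(** In dimension two the antisymmetries in both index pairs leave a single component,
    [L i0 i1 i0 i1], equal to the sectional curvature times det G. Raising an index with the
    explicit inverse makes each Ricci entry a multiple of the metric entry. *)
Lemma ricci_gauss (R : realType) (G : 'rV[R]_2 -> 'M[R]_2) (U : set 'rV[R]_2) y :
  open U -> smooth_on U G -> (forall z, U z -> (G z)^T = G z) ->
  (forall z, U z -> G z \in unitmx) -> U y ->
  ricci_mx G y = sectional G y (\row_k (k == 0 :> nat)%:R) (\row_k (k == 1 :> nat)%:R) *: G y.
Proof.
move=> oU sG G_sym G_unit Uy.
pose L := lowered_riemann G.
have La l k i j : L l k i j y = - L k l i j y by exact: (lowered_riemann_antisym oU).
have Lb l k i j : L l k i j y = - L l k j i y.
  by rewrite /L /lowered_riemann -sumrN; apply: eq_bigr => m _; rewrite -mulrN -riemann_antisym.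
have Ld k i j : L k k i j y = 0.
  by have := La k k i j; lra.
have Le l k i : L l k i i y = 0 by have := Lb l k i i; lra.
pose i0 : 'I_2 := ord0; pose i1 : 'I_2 := lift ord0 ord0.
have sum2 (f : 'I_2 -> R) : \sum_i f i = f i0 + f i1 by rewrite big_ord_recl big_ord1.
have gs : G y i1 i0 = G y i0 i1 by exact: (G_symE G_sym).
pose D := G y i0 i0 * G y i1 i1 - G y i0 i1 ^+ 2.
have [D0 [a00 a01 a10 a11]] : D != 0 /\ [/\ invmx (G y) i0 i0 = G y i1 i1 / D,
    invmx (G y) i0 i1 = - G y i0 i1 / D, invmx (G y) i1 i0 = - G y i0 i1 / D
    & invmx (G y) i1 i1 = G y i0 i0 / D].
  have := mulVmx (G_unit y Uy); move: (invmx (G y)) => X XG.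
  have e i j : X i i0 * G y i0 j + X i i1 * G y i1 j = (i == j)%:R.
    by move/matrixP: XG => /(_ i j); rewrite !mxE sum2.
  have := (e i0 i0, e i0 i1, e i1 i0, e i1 i1); rewrite !eqxx /= /D gs.
  by move=> [[[e0 e1] e2] e3]; exact: inverse_sym2.
have p0 : forall l, curvature_op G y (\row_k (k == 0 :> nat)%:R) (\row_k (k == 1 :> nat)%:R)
   (\row_k (k == 1 :> nat)%:R) 0 l = riemann G l i1 i0 i1 y.
  move=> l; rewrite /curvature_op; move: (riemann G) => Rm; rewrite mxE !sum2 !mxE /=.
  by rewrite !(mulr0, mulr1, mul0r, addr0, add0r).
have bE u v : bilin (G y) u v = u 0 i0 * (G y i0 i0 * v 0 i0 + G y i0 i1 * v 0 i1)
    + u 0 i1 * (G y i0 i1 * v 0 i0 + G y i1 i1 * v 0 i1).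
  rewrite /bilin mxE !sum2 !mxE !sum2 gs; ring.
have K : sectional G y (\row_k (k == 0 :> nat)%:R) (\row_k (k == 1 :> nat)%:R) =
    L i0 i1 i0 i1 y / D.
  rewrite /sectional !bE !p0 /D; rewrite !mxE /=.
  rewrite /L /lowered_riemann sum2 !(mulr0, mulr1, mul0r, mul1r, addr0, add0r).
  move: (riemann G) => Rm.
  by rewrite [_ * G y i0 i0]mulrC [_ * G y i0 i1]mulrC.
rewrite K; apply/matrixP => j k; rewrite !mxE sum2.
rewrite !(raise_riemann G_unit _ _ _ _ Uy) !sum2 -/L a00 a01 a10 a11.
have j01 (P : 'I_2 -> Prop) : P i0 -> P i1 -> forall i, P i.
  move=> P0 P1 i; case: (unliftP ord0 i) => [i'|] ->; last exact: P0.
  by rewrite (ord1 i').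
clearbody L.
have R10 := La i1 i0 i1 i0; have R01 := La i1 i0 i0 i1; have R0110 := Lb i0 i1 i1 i0.
by move: j k; apply: (j01 _); apply: (j01 _); rewrite !Ld !Le ?R10 ?R01 ?R0110 ?gs; field.
Qed.

(** * Curvature of the ambient metric in coordinates *)

Section AmbientCoordinates.
Context {R : realType} {n : nat}.

(* the indices of the coordinates t, rho and x_k *)
Definition ix_t : 'I_(1 + (1 + n)) := lshift (1 + n) ord0.
Definition ix_r : 'I_(1 + (1 + n)) := rshift 1 (lshift n ord0).
Definition ix_m (k : 'I_n) : 'I_(1 + (1 + n)) := rshift 1 (rshift 1 k).

Lemma sum_ambient (V : nmodType) (f : 'I_(1 + (1 + n)) -> V) :
  \sum_a f a = f ix_t + (f ix_r + \sum_k f (ix_m k)).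
Proof. by rewrite !big_split_ord !big_ord1. Qed.

Lemma ambient_ind (P : 'I_(1 + (1 + n)) -> Prop) :
  P ix_t -> P ix_r -> (forall k, P (ix_m k)) -> forall a, P a.
Proof.
move=> Pt Pr Pm a; case: (split_ordP a) => [a0 ->|b ->]; first by rewrite (ord1 a0).
by case: (split_ordP b) => [b0 ->|k ->]; [rewrite (ord1 b0)|exact: Pm].
Qed.

Lemma ambient_eqE : (ix_t == ix_t = true) * (ix_t == ix_r = false) * (ix_r == ix_t = false) *
  (ix_r == ix_r = true) * (forall k, ix_t == ix_m k = false) * (forall k, ix_m k == ix_t = false) *
  (forall k, ix_r == ix_m k = false) * (forall k, ix_m k == ix_r = false) *
  (forall i j, (ix_m i == ix_m j) = (i == j)).
Proof.
by do ![split]; move=> *; rewrite /ix_t /ix_r /ix_m ?eqxx ?eq_lrshift ?eq_rlshift //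
  !eq_rshift ?eq_lrshift ?eq_rlshift.
Qed.

Variable F : 'rV[R]_(1 + n) -> 'M[R]_n.

(** Built from the same blocks as [ambient_metric], so that the two match after unfolding; F stands
    for the slice metrics as functions of (rho, x). *)
Definition ambient_mx (z : 'rV[R]_(1 + (1 + n))) : 'M[R]_(1 + (1 + n)) :=
  let t := z 0 ix_t in
  let r := z 0 ix_r in
  let dt := row_mx 1%:M 0 in
  let drho := row_mx 0 (row_mx 1%:M 0) in
  let drhot := r *: dt + t *: drho in
  outer drhot dt + outer dt drhot
  + t ^+ 2 *: block_mx 0 0 0 (block_mx 0 0 0 (F (rsubmx z))).

Lemma outerE m (a b : 'rV[R]_m) i j : outer a b i j = a 0 i * b 0 j.
Proof. by rewrite /outer mxE big_ord1 mxE. Qed.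

Lemma ambient_mxE z :
  (ambient_mx z ix_t ix_t = 2 * z 0 ix_r) *
  (ambient_mx z ix_t ix_r = z 0 ix_t) *
  (ambient_mx z ix_r ix_t = z 0 ix_t) *
  (ambient_mx z ix_r ix_r = 0) *
  (forall j, ambient_mx z ix_t (ix_m j) = 0) *
  (forall j, ambient_mx z (ix_m j) ix_t = 0) *
  (forall j, ambient_mx z ix_r (ix_m j) = 0) *
  (forall j, ambient_mx z (ix_m j) ix_r = 0) *
  (forall i j, ambient_mx z (ix_m i) (ix_m j) = z 0 ix_t ^+ 2 * F (rsubmx z) i j).
Proof.
pose dt : 'rV[R]_(1 + (1 + n)) := row_mx 1%:M 0.
pose dr : 'rV[R]_(1 + (1 + n)) := row_mx 0 (row_mx 1%:M 0).
have E i j : ambient_mx z i j =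
    (z 0 ix_r * dt 0 i + z 0 ix_t * dr 0 i) * dt 0 j
    + dt 0 i * (z 0 ix_r * dt 0 j + z 0 ix_t * dr 0 j)
    + z 0 ix_t ^+ 2 * block_mx 0 0 0 (block_mx 0 0 0 (F (rsubmx z))) i j.
  have addE p q (A B : 'M[R]_(p, q)) a b : (A + B) a b = A a b + B a b by rewrite mxE.
  have scaleE p q c (A : 'M[R]_(p, q)) a b : (c *: A) a b = c * A a b by rewrite mxE.
  by rewrite /ambient_mx /= !addE !outerE !(addE, scaleE).
have e1 : (1%:M : 'M[R]_1) 0 ord0 = 1 by rewrite mxE.
have z0 p q (a : 'I_p) (b : 'I_q) : (0 : 'M[R]_(p, q)) a b = 0 by rewrite mxE.
do ![split]; move=> *; rewrite E /dt /dr /ix_t /ix_r /ix_m ?(row_mxEl, row_mxEr)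
  ?(block_mxEul, block_mxEur, block_mxEdl, block_mxEdr) ?e1 ?z0; ring.
Qed.

(** The (t, rho) block with rows (2 rho, t) and (t, 0) has the inverse with rows (0, 1/t) and (1/t,
    - 2 rho / t^2). *)
Definition ambient_inv (z : 'rV[R]_(1 + (1 + n))) : 'M[R]_(1 + (1 + n)) :=
  let t := z 0 ix_t in
  block_mx 0 (row_mx t^-1%:M 0) (col_mx t^-1%:M 0)
    (block_mx (- (2 * z 0 ix_r / t ^+ 2))%:M 0 0 (t ^- 2 *: invmx (F (rsubmx z)))).

Lemma ambient_invE z :
  (ambient_inv z ix_t ix_t = 0) *
  (ambient_inv z ix_t ix_r = (z 0 ix_t)^-1) *
  (ambient_inv z ix_r ix_t = (z 0 ix_t)^-1) *
  (ambient_inv z ix_r ix_r = - (2 * z 0 ix_r / z 0 ix_t ^+ 2)) *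
  (forall j, ambient_inv z ix_t (ix_m j) = 0) *
  (forall j, ambient_inv z (ix_m j) ix_t = 0) *
  (forall j, ambient_inv z ix_r (ix_m j) = 0) *
  (forall j, ambient_inv z (ix_m j) ix_r = 0) *
  (forall i j, ambient_inv z (ix_m i) (ix_m j) = z 0 ix_t ^- 2 * invmx (F (rsubmx z)) i j).
Proof.
have e1 (x : R) : (x%:M : 'M[R]_1) ord0 ord0 = x by rewrite mxE eqxx mulr1n.
have z0 p q (a : 'I_p) (b : 'I_q) : (0 : 'M[R]_(p, q)) a b = 0 by rewrite mxE.
do ![split]; move=> *; rewrite /ambient_inv /ix_t /ix_r /ix_m
  ?(block_mxEul, block_mxEur, block_mxEdl, block_mxEdr, row_mxEl, row_mxEr,
    col_mxEu, col_mxEd) ?e1 ?z0 //.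
by rewrite mxE.
Qed.

Variable W : set 'rV[R]_(1 + n).
Hypothesis oW : open W.
Hypothesis sF : smooth_on W F.
Hypothesis F_sym : forall w, W w -> (F w)^T = F w.
Hypothesis F_unit : forall w, W w -> F w \in unitmx.

Definition ambient_dom : set 'rV[R]_(1 + (1 + n)) :=
  [set z : 'rV[R]_(1 + (1 + n)) | 0 < z 0 ix_t /\ W (rsubmx z)].

Lemma open_ambient_dom : open ambient_dom.
Proof.
apply: openI.
  apply: (@open_comp _ _ (fun z : 'rV[R]_(1 + (1 + n)) => z 0 ix_t) [set t | 0 < t]).
    by move=> z _; exact: coord_continuous.
  exact: open_gt.
by apply: open_comp => // z _; exact: continuous_rsubmx.
Qed.

Lemma invmx_ambient z : ambient_dom z -> invmx (ambient_mx z) = ambient_inv z.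
Proof.
case=> t0 Wz; have t00 : z 0 ix_t != 0 by rewrite gt_eqF.
suff E : ambient_mx z *m ambient_inv z = 1%:M.
  have [U _] := mulmx1_unit E.
  by rewrite -[RHS](mulKmx U) E mulmx1.
have FV := mulmxV (F_unit Wz).
apply/matrixP => a b; rewrite mxE sum_ambient.
have Sit b' : \sum_k ambient_mx z ix_t (ix_m k) * ambient_inv z (ix_m k) b' = 0.
  by rewrite big1 // => k _; rewrite ambient_mxE mul0r.
have Sir b' : \sum_k ambient_mx z ix_r (ix_m k) * ambient_inv z (ix_m k) b' = 0.
  by rewrite big1 // => k _; rewrite ambient_mxE mul0r.
have Srt i : \sum_k ambient_mx z i (ix_m k) * ambient_inv z (ix_m k) ix_t = 0.
  by rewrite big1 // => k _; rewrite ambient_invE mulr0.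
have Srr i : \sum_k ambient_mx z i (ix_m k) * ambient_inv z (ix_m k) ix_r = 0.
  by rewrite big1 // => k _; rewrite ambient_invE mulr0.
have FE i j : \sum_k (z 0 ix_t ^+ 2 * F (rsubmx z) i k) *
    (z 0 ix_t ^- 2 * invmx (F (rsubmx z)) k j) = (i == j)%:R.
  move/matrixP: FV => /(_ i j); rewrite !mxE => <-; apply: eq_bigr => k _.
  by field.
have SE i j : \sum_k ambient_mx z (ix_m i) (ix_m k) * ambient_inv z (ix_m k) (ix_m j) = (i == j)%:R.
  by rewrite -FE; apply: eq_bigr => k _; rewrite ambient_mxE ambient_invE.
rewrite [RHS]mxE; move: a b; apply: ambient_ind => [||i]; apply: ambient_ind => [||j];
  rewrite !(Sit, Sir, Srt, Srr, SE) !(ambient_mxE, ambient_invE, ambient_eqE) /=; by field.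
Qed.

(* [F w] is the slice metric h at [w = (rho, x)]; [slice_dr] is dh/drho and
   [slice_dm k] is dh/dx_k. *)
Definition slice_dr i j (w : 'rV[R]_(1 + n)) : R :=
  'D_(delta_mx 0 (lshift n ord0)) (fun w => F w i j) w.

Definition slice_dm k i j (w : 'rV[R]_(1 + n)) : R :=
  'D_(delta_mx 0 (rshift 1 k)) (fun w => F w i j) w.

Definition slice_christoffel k i j (w : 'rV[R]_(1 + n)) : R :=
  \sum_l invmx (F w) k l *
    (2^-1 * (slice_dm i j l w + slice_dm j i l w - slice_dm l i j w)).

Lemma linear_coord (m : nat) (a : 'I_m) : linear (fun z : 'rV[R]_m => z 0 a).
Proof. by move=> c u v; rewrite !mxE. Qed.

Lemma pderiv_coord (m : nat) (a b : 'I_m) (z : 'rV[R]_m) :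
  pderiv a (fun z => z 0 b) z = (a == b)%:R.
Proof.
rewrite /pderiv derive_linear; [|exact: linear_coord|exact: coord_continuous].
by rewrite mxE eqxx eq_sym.
Qed.

Lemma derivable_coord (m : nat) (b : 'I_m) (z v : 'rV[R]_m) :
  derivable (fun z : 'rV[R]_m => z 0 b) z v.
Proof.
apply/diff_derivable/differentiable_linear; first exact: linear_coord.
exact: coord_continuous.
Qed.

Lemma rsubmx_delta : (rsubmx (delta_mx 0 ix_t : 'rV[R]_(1 + (1 + n))) = 0) *
  (rsubmx (delta_mx 0 ix_r : 'rV[R]_(1 + (1 + n))) = delta_mx 0 (lshift n ord0)) *
  (forall k, rsubmx (delta_mx 0 (ix_m k) : 'rV[R]_(1 + (1 + n))) = delta_mx 0 (rshift 1 k)).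
Proof.
do ![split]; [|move|move=> k]; apply/rowP => j; rewrite [LHS]mxE [LHS]mxE [RHS]mxE eqxx andTb.
- by rewrite /ix_t eq_rlshift.
- by rewrite /ix_r eq_rshift.
- by rewrite /ix_m eq_rshift.
Qed.

Lemma pderiv_ambient_mx z : ambient_dom z ->
  (forall a, pderiv a (fun z => ambient_mx z ix_t ix_t) z = 2 * (a == ix_r)%:R) *
  (forall a, pderiv a (fun z => ambient_mx z ix_t ix_r) z = (a == ix_t)%:R) *
  (forall a, pderiv a (fun z => ambient_mx z ix_r ix_t) z = (a == ix_t)%:R) *
  (forall a, pderiv a (fun z => ambient_mx z ix_r ix_r) z = 0) *
  (forall a j, pderiv a (fun z => ambient_mx z ix_t (ix_m j)) z = 0) *
  (forall a j, pderiv a (fun z => ambient_mx z (ix_m j) ix_t) z = 0) *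
  (forall a j, pderiv a (fun z => ambient_mx z ix_r (ix_m j)) z = 0) *
  (forall a j, pderiv a (fun z => ambient_mx z (ix_m j) ix_r) z = 0) *
  (forall i j, pderiv ix_t (fun z => ambient_mx z (ix_m i) (ix_m j)) z =
     2 * z 0 ix_t * F (rsubmx z) i j) *
  (forall i j, pderiv ix_r (fun z => ambient_mx z (ix_m i) (ix_m j)) z =
     z 0 ix_t ^+ 2 * slice_dr i j (rsubmx z)) *
  (forall k i j, pderiv (ix_m k) (fun z => ambient_mx z (ix_m i) (ix_m j)) z =
     z 0 ix_t ^+ 2 * slice_dm k i j (rsubmx z)).
Proof.
move=> [t0 Wz].
have cst0 a b c : (forall z, ambient_mx z b c = 0) -> pderiv a (fun z => ambient_mx z b c) z = 0.
  move=> H; have -> : (fun z => ambient_mx z b c) = cst 0 by apply/funext.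
  by rewrite /pderiv derive_cst.
have coord a b c d : (forall z, ambient_mx z b c = z 0 d) ->
    pderiv a (fun z => ambient_mx z b c) z = (a == d)%:R.
  by move=> /funext H; rewrite H pderiv_coord.
(* One product rule for t^2 F serves all directions: [rsubmx] sends the t basis vector to 0 and the
   others to the basis vectors of (rho, x). *)
have blockE a i j : pderiv a (fun z => ambient_mx z (ix_m i) (ix_m j)) z =
    z 0 ix_t ^+ 2 * 'D_(rsubmx (delta_mx 0 a)) (fun w => F w i j) (rsubmx z)
    + 2 * z 0 ix_t * (a == ix_t)%:R * F (rsubmx z) i j.
  pose c (z : 'rV[R]_(1 + (1 + n))) : R := z 0 ix_t.
  pose f2 (z : 'rV[R]_(1 + (1 + n))) : R := F (rsubmx z) i j.
  have -> : (fun z => ambient_mx z (ix_m i) (ix_m j)) = (c * c) * f2.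
    by apply/funext => y; rewrite ambient_mxE expr2.
  have dr : derivable f2 z (delta_mx 0 a).
    apply/diff_derivable/(@differentiable_comp _ _ _ _ rsubmx (fun w => F w i j)).
      exact: differentiable_rsubmx.
    exact: (smooth_on_differentiable (smooth_on_entry i j oW sF)).
  have dt : derivable c z (delta_mx 0 a) by exact: derivable_coord.
  have Dc : 'D_(delta_mx 0 a) c z = (a == ix_t)%:R by exact: pderiv_coord.
  have Df : 'D_(delta_mx 0 a) f2 z = 'D_(rsubmx (delta_mx 0 a)) (fun w => F w i j) (rsubmx z).
    by apply: (@derive_comp_linear _ _ _ _ (fun w => F w i j) rsubmx); exact: linearP.
  have dt2 := derivableM dt dt.
  rewrite /pderiv (deriveM dt2 dr) (deriveM dt dt) Dc Df.
  rewrite -![_ *: _]/(_ * _) /f2 fctE /c.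
  move: ('D__ _ _) => D'; ring.
have d0 i j : 'D_0 (fun w => F w i j) (rsubmx z) = 0 by rewrite derive0.
do ![split].
- move=> a; have -> : (fun z => ambient_mx z ix_t ix_t) = (fun z => 2 *: z 0 ix_r).
    by apply/funext => y; rewrite ambient_mxE.
  rewrite /pderiv deriveZ; last exact: derivable_coord.
  by rewrite -/(pderiv a _ z) pderiv_coord.
- by move=> a; apply: coord => y; rewrite ambient_mxE.
- by move=> a; apply: coord => y; rewrite ambient_mxE.
- by move=> a; apply: cst0 => y; rewrite ambient_mxE.
- by move=> a j; apply: cst0 => y; rewrite ambient_mxE.
- by move=> a j; apply: cst0 => y; rewrite ambient_mxE.
- by move=> a j; apply: cst0 => y; rewrite ambient_mxE.
- by move=> a j; apply: cst0 => y; rewrite ambient_mxE.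
- by move=> i j; rewrite blockE rsubmx_delta d0 eqxx mulr0 add0r mulr1.
- by move=> i j; rewrite blockE rsubmx_delta ambient_eqE mulr0 mul0r addr0.
- by move=> k i j; rewrite blockE rsubmx_delta ambient_eqE mulr0 mul0r addr0.
Qed.

Lemma christoffel1_ambient z : ambient_dom z ->
  let t := z 0 ix_t in let w := rsubmx z in
  let c1 := christoffel1 ambient_mx in
  (c1 ix_t ix_t ix_t z = 0) * (c1 ix_t ix_t ix_r z = 1) *
  (c1 ix_t ix_r ix_t z = 1) * (c1 ix_t ix_r ix_r z = 0) *
  (forall j, c1 ix_t ix_t (ix_m j) z = 0) * (forall j, c1 ix_t (ix_m j) ix_t z = 0) *
  (forall j, c1 ix_t ix_r (ix_m j) z = 0) * (forall j, c1 ix_t (ix_m j) ix_r z = 0) *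
  (forall i j, c1 ix_t (ix_m i) (ix_m j) z = - (t * F w i j)) *
  (c1 ix_r ix_t ix_t z = 0) * (c1 ix_r ix_t ix_r z = 0) *
  (c1 ix_r ix_r ix_t z = 0) * (c1 ix_r ix_r ix_r z = 0) *
  (forall j, c1 ix_r ix_t (ix_m j) z = 0) * (forall j, c1 ix_r (ix_m j) ix_t z = 0) *
  (forall j, c1 ix_r ix_r (ix_m j) z = 0) * (forall j, c1 ix_r (ix_m j) ix_r z = 0) *
  (forall i j, c1 ix_r (ix_m i) (ix_m j) z = - (2^-1 * t ^+ 2 * slice_dr i j w)) *
  (forall l, c1 (ix_m l) ix_t ix_t z = 0) * (forall l, c1 (ix_m l) ix_t ix_r z = 0) *
  (forall l, c1 (ix_m l) ix_r ix_t z = 0) * (forall l, c1 (ix_m l) ix_r ix_r z = 0) *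
  (forall l j, c1 (ix_m l) ix_t (ix_m j) z = t * F w j l) *
  (forall l j, c1 (ix_m l) (ix_m j) ix_t z = t * F w j l) *
  (forall l j, c1 (ix_m l) ix_r (ix_m j) z = 2^-1 * t ^+ 2 * slice_dr j l w) *
  (forall l j, c1 (ix_m l) (ix_m j) ix_r z = 2^-1 * t ^+ 2 * slice_dr j l w) *
  (forall l i j, c1 (ix_m l) (ix_m i) (ix_m j) z =
    t ^+ 2 * (2^-1 * (slice_dm i j l w + slice_dm j i l w - slice_dm l i j w))).
Proof.
move=> Dz t w c1; do ![split]; move=> *;
  rewrite /c1 /christoffel1 !(pderiv_ambient_mx Dz) ?ambient_eqE /= /t /w; by field.
Qed.

(* h^-1 (dh/drho) / 2 *)
Definition slice_shape k j (w : 'rV[R]_(1 + n)) : R :=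
  2^-1 * \sum_l invmx (F w) k l * slice_dr j l w.

Lemma christoffel_ambient z : ambient_dom z ->
  let t := z 0 ix_t in let w := rsubmx z in
  let ch := christoffel ambient_mx in
  (ch ix_t ix_t ix_t z = 0) * (ch ix_t ix_t ix_r z = 0) *
  (ch ix_t ix_r ix_t z = 0) * (ch ix_t ix_r ix_r z = 0) *
  (forall j, ch ix_t ix_t (ix_m j) z = 0) * (forall j, ch ix_t (ix_m j) ix_t z = 0) *
  (forall j, ch ix_t ix_r (ix_m j) z = 0) * (forall j, ch ix_t (ix_m j) ix_r z = 0) *
  (forall i j, ch ix_t (ix_m i) (ix_m j) z = - (2^-1 * t * slice_dr i j w)) *
  (ch ix_r ix_t ix_t z = 0) * (ch ix_r ix_t ix_r z = t^-1) * (ch ix_r ix_r ix_t z = t^-1) *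
  (ch ix_r ix_r ix_r z = 0) *
  (forall j, ch ix_r ix_t (ix_m j) z = 0) * (forall j, ch ix_r (ix_m j) ix_t z = 0) *
  (forall j, ch ix_r ix_r (ix_m j) z = 0) * (forall j, ch ix_r (ix_m j) ix_r z = 0) *
  (forall i j, ch ix_r (ix_m i) (ix_m j) z = z 0 ix_r * slice_dr i j w - F w i j) *
  (forall k, ch (ix_m k) ix_t ix_t z = 0) * (forall k, ch (ix_m k) ix_t ix_r z = 0) *
  (forall k, ch (ix_m k) ix_r ix_t z = 0) * (forall k, ch (ix_m k) ix_r ix_r z = 0) *
  (forall k j, ch (ix_m k) ix_t (ix_m j) z = (k == j)%:R * t^-1) *
  (forall k j, ch (ix_m k) (ix_m j) ix_t z = (k == j)%:R * t^-1) *
  (forall k j, ch (ix_m k) ix_r (ix_m j) z = slice_shape k j w) *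
  (forall k j, ch (ix_m k) (ix_m j) ix_r z = slice_shape k j w) *
  (forall k i j, ch (ix_m k) (ix_m i) (ix_m j) z = slice_christoffel k i j w).
Proof.
move=> Dz t w ch; have [t0 Wz] := Dz; have t_neq0 : z 0 ix_t != 0 by rewrite gt_eqF.
have chE k i j : ch k i j z = \sum_l ambient_inv z k l * christoffel1 ambient_mx l i j z.
  by rewrite /ch christoffelE invmx_ambient.
(* The inverse metric pairs t with rho only, rho with t and rho, and the x directions among
   themselves; this gives one reduction for each kind of upper index. *)
have ch_t i j : ch ix_t i j z = (z 0 ix_t)^-1 * christoffel1 ambient_mx ix_r i j z.
  rewrite chE sum_ambient !ambient_invE mul0r add0r big1 ?addr0 // => l _.
  by rewrite ambient_invE mul0r.
have ch_r i j : ch ix_r i j z = (z 0 ix_t)^-1 * christoffel1 ambient_mx ix_t i j z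
    - 2 * z 0 ix_r / z 0 ix_t ^+ 2 * christoffel1 ambient_mx ix_r i j z.
  rewrite chE sum_ambient !ambient_invE mulNr big1 ?addr0 // => l _.
  by rewrite ambient_invE mul0r.
have z3 (a b c : R) : 0 * a + (0 * b + c) = c by rewrite !mul0r !add0r.
have ch_m k i j : ch (ix_m k) i j z = z 0 ix_t ^- 2 *
    \sum_l invmx (F w) k l * christoffel1 ambient_mx (ix_m l) i j z.
  rewrite chE sum_ambient !ambient_invE z3 [RHS]mulr_sumr; apply: eq_bigr => l _.
  by rewrite ambient_invE; exact/esym/mulrA.
have FV k j : \sum_l invmx (F w) k l * F w j l = (k == j)%:R.
  have /matrixP/(_ k j) := mulVmx (F_unit Wz); rewrite !mxE => <-.
  apply: eq_bigr => l _; congr (_ * _).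
  by move/matrixP: (F_sym Wz) => /(_ l j); rewrite mxE.
have sum0 k i j : (forall l, christoffel1 ambient_mx (ix_m l) i j z = 0) -> ch (ix_m k) i j z = 0.
  by move=> c0; rewrite ch_m big1 ?mulr0 // => l _; rewrite c0 mulr0.
have sumt k i j m : (forall l, christoffel1 ambient_mx (ix_m l) i j z = z 0 ix_t * F w m l) ->
    ch (ix_m k) i j z = (k == m)%:R * t^-1.
  move=> c0; rewrite ch_m -FV mulr_suml mulr_sumr; apply: eq_bigr => l _.
  by rewrite c0 /t; field.
have sumr k i j m : (forall l, christoffel1 ambient_mx (ix_m l) i j z =
    2^-1 * z 0 ix_t ^+ 2 * slice_dr m l w) -> ch (ix_m k) i j z = slice_shape k m w.
  move=> c0; rewrite ch_m /slice_shape !mulr_sumr; apply: eq_bigr => l _.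
  by rewrite c0; field.
do ![split]; try by move=> *; rewrite ?ch_t ?ch_r !(christoffel1_ambient Dz) /t /w; field.
- by move=> k; apply: sum0 => l; rewrite (christoffel1_ambient Dz).
- by move=> k; apply: sum0 => l; rewrite (christoffel1_ambient Dz).
- by move=> k; apply: sum0 => l; rewrite (christoffel1_ambient Dz).
- by move=> k; apply: sum0 => l; rewrite (christoffel1_ambient Dz).
- by move=> k j; apply: sumt => l; rewrite (christoffel1_ambient Dz).
- by move=> k j; apply: sumt => l; rewrite (christoffel1_ambient Dz).
- by move=> k j; apply: sumr => l; rewrite (christoffel1_ambient Dz).
- by move=> k j; apply: sumr => l; rewrite (christoffel1_ambient Dz).
move=> k i j; rewrite ch_m /slice_christoffel mulr_sumr; apply: eq_bigr => l _.
rewrite (christoffel1_ambient Dz) -/w.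
by rewrite mulrCA mulKf // expf_neq0.
Qed.

Lemma slice_dr_sym i j w : W w -> slice_dr i j w = slice_dr j i w.
Proof.
move=> Ww; apply: near_eq_derive; near=> u; have Wu : W u.
  by near: u; exact: open_nbhs_nbhs.
by rewrite -[in LHS](F_sym Wu) mxE.
Unshelve. all: by end_near. Qed.

Lemma row_mx0_delta k : row_mx 0 (delta_mx 0 k) = delta_mx 0 (rshift 1 k) :> 'rV[R]_(1 + n).
Proof.
apply/rowP => p; case: (split_ordP p) => q ->.
  by rewrite row_mxEl !mxE eq_lrshift andbF.
by rewrite row_mxEr !mxE eq_rshift.
Qed.

Lemma slice_christoffel_zero k i j y :
  slice_christoffel k i j (row_mx 0 y) = christoffel (F \o row_mx 0) k i j y.
Proof.
rewrite /christoffel mulr_sumr; apply: eq_bigr => l _; rewrite mulrCA.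
have E a b c : pderiv a (fun z => (F \o row_mx 0) z b c) y = slice_dm a b c (row_mx 0 y).
  rewrite /pderiv (@derive_comp_linear _ _ _ _ (fun w => F w b c) (row_mx 0)); last first.
    by move=> e u v; rewrite scale_row_mx add_row_mx scaler0 addr0.
  by rewrite row_mx0_delta.
by rewrite !E.
Qed.

Lemma slice_dm_sym k i j w : W w -> slice_dm k i j w = slice_dm k j i w.
Proof.
move=> Ww; apply: near_eq_derive; near=> u; have Wu : W u.
  by near: u; exact: open_nbhs_nbhs.
by rewrite -[in LHS](F_sym Wu) mxE.
Unshelve. all: by end_near. Qed.

Lemma slice_christoffel_sym k i j w : W w ->
  slice_christoffel k i j w = slice_christoffel k j i w.
Proof.
move=> Ww; apply: eq_bigr => l _.
by rewrite [slice_dm i j l w + _]addrC (slice_dm_sym l i j Ww).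
Qed.

Lemma slice_shapeE j k w : W w ->
  \sum_m F w j m * slice_shape m k w = 2^-1 * slice_dr j k w.
Proof.
move=> Ww; under eq_bigr do rewrite mulrCA mulr_sumr.
rewrite -mulr_sumr exchange_big /=; congr (_ * _).
transitivity (\sum_l (j == l)%:R * slice_dr l k w).
  apply: eq_bigr => l _; rewrite (slice_dr_sym l k Ww).
  have /matrixP/(_ j l) := mulmxV (F_unit Ww); rewrite !mxE => <-.
  by rewrite mulr_suml; apply: eq_bigr => m _; rewrite mulrA.
rewrite (bigD1 j) //= eqxx mul1r big1 ?addr0 // => l lj.
by rewrite eq_sym (negbTE lj) mul0r.
Qed.

(** * Curvature and Ricci tensor at points with rho = 0 *)

Section AtOrigin.
Variable z : 'rV[R]_(1 + (1 + n)).
Hypothesis Dz : ambient_dom z.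
Hypothesis z0 : z 0 ix_r = 0.
Let t := z 0 ix_t.
Let w := rsubmx z.
Let y := rsubmx w.

Lemma origin_slice : w = row_mx 0 y.
Proof.
rewrite -[LHS]hsubmxK; congr row_mx; apply/rowP => i; rewrite (ord1 i) !mxE.
by rewrite -[RHS]z0; congr (z _ _); exact: val_inj.
Qed.

(** The formulas of [christoffel_ambient] hold on an open set, so they may be differentiated. *)
Let pd (f : 'rV[R]_(1 + (1 + n)) -> R) a k i j :
  (forall z, ambient_dom z -> christoffel ambient_mx k i j z = f z) ->
  pderiv a (christoffel ambient_mx k i j) z = pderiv a f z.
Proof. by move=> H; apply: (pderiv_eq a open_ambient_dom Dz). Qed.

Let pd0 a k i j : (forall z, ambient_dom z -> christoffel ambient_mx k i j z = 0) ->
  pderiv a (christoffel ambient_mx k i j) z = 0.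
Proof. by move=> H; rewrite (pd a (f := cst 0)) // /pderiv derive_cst. Qed.

Lemma pderiv_inv_t (c : R) a :
  pderiv a (fun z : 'rV[R]_(1 + (1 + n)) => c * (z 0 ix_t)^-1) z = - (c * (a == ix_t)%:R / t ^+ 2).
Proof.
have [t0 _] := Dz; have t_neq0 : z 0 ix_t != 0 by rewrite gt_eqF.
pose f (z : 'rV[R]_(1 + (1 + n))) : R := z 0 ix_t.
have df : derivable f z (delta_mx 0 a) by exact: derivable_coord.
have Df : 'D_(delta_mx 0 a) f z = (a == ix_t)%:R by exact: pderiv_coord.
rewrite /pderiv (@deriveZ _ _ _ (fun z => (f z)^-1)); last exact: derivableV.
by rewrite deriveV // Df -![_ *: _]/(_ * _) /f -/t; field.
Qed.

Lemma pderiv_ch_rrt a :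
  pderiv a (christoffel ambient_mx ix_r ix_r ix_t) z = - ((a == ix_t)%:R / t ^+ 2).
Proof.
rewrite (pd a (f := fun z => 1 * (z 0 ix_t)^-1)) ?pderiv_inv_t ?mul1r // => u Du.
by rewrite (christoffel_ambient Du) mul1r.
Qed.

Lemma pderiv_ch_mtm a k j :
  pderiv a (christoffel ambient_mx (ix_m k) ix_t (ix_m j)) z =
    - ((k == j)%:R * (a == ix_t)%:R / t ^+ 2).
Proof.
rewrite (pd a (f := fun z => (k == j)%:R * (z 0 ix_t)^-1)) ?pderiv_inv_t // => u Du.
by rewrite (christoffel_ambient Du).
Qed.

Lemma pderiv_ch_mmt a k j :
  pderiv a (christoffel ambient_mx (ix_m k) (ix_m j) ix_t) z =
    - ((k == j)%:R * (a == ix_t)%:R / t ^+ 2).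
Proof.
rewrite (pd a (f := fun z => (k == j)%:R * (z 0 ix_t)^-1)) ?pderiv_inv_t // => u Du.
by rewrite (christoffel_ambient Du).
Qed.

Lemma pderiv_rsubmx a (f : 'rV[R]_(1 + n) -> R) :
  pderiv a (fun z : 'rV[R]_(1 + (1 + n)) => f (rsubmx z)) z =
  'D_(rsubmx (delta_mx 0 a)) f w.
Proof. by apply: (@derive_comp_linear _ _ _ _ f rsubmx); exact: linearP. Qed.

Let sF_ i j : smooth_on W (fun w => F w i j).
Proof. exact: smooth_on_entry. Qed.

Let derivable_rsubmx i j a : derivable (fun z : 'rV[R]_(1 + (1 + n)) => F (rsubmx z) i j) z a.
Proof.
apply/diff_derivable/(@differentiable_comp _ _ _ _ rsubmx (fun w => F w i j)).
  exact: differentiable_rsubmx.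
by have [_ Wz] := Dz; exact: (smooth_on_differentiable (sF_ i j)).
Qed.

Let derivable_dr i j a : derivable (fun z : 'rV[R]_(1 + (1 + n)) => slice_dr i j (rsubmx z)) z a.
Proof.
apply/diff_derivable/(@differentiable_comp _ _ _ _ rsubmx (slice_dr i j)).
  exact: differentiable_rsubmx.
by have [_ Wz] := Dz; exact: (smooth_on_differentiable (smooth_on_derive _ (sF_ i j))).
Qed.

Lemma pderiv_ch_tmm i j :
  pderiv ix_t (christoffel ambient_mx ix_t (ix_m i) (ix_m j)) z = - (2^-1 * slice_dr i j w).
Proof.
pose c (z : 'rV[R]_(1 + (1 + n))) : R := z 0 ix_t.
pose f (z : 'rV[R]_(1 + (1 + n))) : R := slice_dr i j (rsubmx z).
rewrite (pd ix_t (f := (- 2^-1) *: (c * f))); last first.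
  by move=> u Du; rewrite (christoffel_ambient Du) !fctE /= /c /f -[_ *: _]/(_ * _) mulNr mulrA.
have dc : derivable c z (delta_mx 0 ix_t) by exact: derivable_coord.
have df : derivable f z (delta_mx 0 ix_t) by exact: derivable_dr.
have Dc : 'D_(delta_mx 0 ix_t) c z = (ix_t == ix_t)%:R by exact: pderiv_coord.
have Df : 'D_(delta_mx 0 ix_t) f z = 0.
  by rewrite -/(pderiv ix_t f z) pderiv_rsubmx rsubmx_delta derive0.
rewrite /pderiv (deriveZ _ (derivableM dc df)) (deriveM dc df) Dc Df eqxx scaler0 add0r.
by rewrite -![_ *: _]/(_ * _) mulr1 mulNr.
Qed.

(** Differentiating rho h' - h in rho, the two terms h' cancel and the factor rho kills the rest. *)
Lemma pderiv_ch_rmm i j : pderiv ix_r (christoffel ambient_mx ix_r (ix_m i) (ix_m j)) z = 0.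
Proof.
pose c (z : 'rV[R]_(1 + (1 + n))) : R := z 0 ix_r.
pose f (z : 'rV[R]_(1 + (1 + n))) : R := slice_dr i j (rsubmx z).
pose h (z : 'rV[R]_(1 + (1 + n))) : R := F (rsubmx z) i j.
rewrite (pd ix_r (f := c * f - h)); last by move=> u Du; rewrite (christoffel_ambient Du).
have dc : derivable c z (delta_mx 0 ix_r) by exact: derivable_coord.
have df : derivable f z (delta_mx 0 ix_r) by exact: derivable_dr.
have dh : derivable h z (delta_mx 0 ix_r) by exact: derivable_rsubmx.
have Dc : 'D_(delta_mx 0 ix_r) c z = (ix_r == ix_r)%:R by exact: pderiv_coord.
have Dh : 'D_(delta_mx 0 ix_r) h z = slice_dr i j w.
  rewrite -/(pderiv ix_r h z) (pderiv_rsubmx ix_r (fun w => F w i j)).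
  by rewrite rsubmx_delta.
rewrite /pderiv (deriveB (derivableM dc df) dh) (deriveM dc df) Dc Dh eqxx.
by rewrite -![_ *: _]/(_ * _) /c z0 mul0r add0r mulr1 subrr.
Qed.

Lemma pderiv_ch_mmm_t k i j : pderiv ix_t (christoffel ambient_mx (ix_m k) (ix_m i) (ix_m j)) z = 0.
Proof.
rewrite (pd ix_t (f := fun z => slice_christoffel k i j (rsubmx z))); last first.
  by move=> u Du; rewrite (christoffel_ambient Du).
by rewrite pderiv_rsubmx rsubmx_delta derive0.
Qed.

Lemma pderiv_ch_mmm a k i j :
  pderiv (ix_m a) (christoffel ambient_mx (ix_m k) (ix_m i) (ix_m j)) z =
  pderiv a (christoffel (F \o row_mx 0) k i j) y.
Proof.
rewrite (pd (ix_m a) (f := fun z => slice_christoffel k i j (rsubmx z))); last first.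
  by move=> u Du; rewrite (christoffel_ambient Du).
rewrite pderiv_rsubmx rsubmx_delta origin_slice.
have -> : christoffel (F \o row_mx 0) k i j = slice_christoffel k i j \o row_mx 0.
  by apply/funext => v; rewrite /= slice_christoffel_zero.
rewrite /pderiv derive_comp_linear; last first.
  by move=> e u v; rewrite scale_row_mx add_row_mx scaler0 addr0.
by rewrite row_mx0_delta.
Qed.

Let chA := christoffel_ambient Dz.
Let Wz : W w. Proof. by have [] := Dz. Qed.
Let t_neq0 : t != 0. Proof. by have [t0 _] := Dz; rewrite gt_eqF. Qed.

Let sum_delta (f : 'I_n -> R) k : \sum_m f m * ((m == k)%:R * t^-1) = f k / t.
Proof.
rewrite (bigD1 k) //= eqxx mul1r big1 ?addr0 // => m /negbTE ->.
by rewrite mul0r mulr0.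
Qed.

Let sum_delta' (f : 'I_n -> R) k : \sum_m (k == m)%:R * t^-1 * f m = f k / t.
Proof. by rewrite -sum_delta; apply: eq_bigr => m _; rewrite mulrC eq_sym. Qed.

Let sum_zero (f g f' g' : 'I_n -> R) : (forall m, f m * g m = 0) -> (forall m, f' m * g' m = 0) ->
  \sum_m (f m * g m - f' m * g' m) = 0.
Proof. by move=> h h'; rewrite big1 // => m _; rewrite h h' subr0. Qed.

Lemma riemann_diag l k i : riemann ambient_mx l k i i z = 0.
Proof. by have := riemann_antisym ambient_mx l k i i z; lra. Qed.

(* The suffixes t, r, m give the kinds of the four indices of the Riemann
   tensor; only those combinations entering the Ricci tensor are needed. *)
Lemma riemann_rtrt : riemann ambient_mx ix_r ix_t ix_r ix_t z = 0.
Proof.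
rewrite /riemann sum_ambient pderiv_ch_rrt
  (pd0 ix_r (k := ix_r) (i := ix_t) (j := ix_t)); last first.
  by move=> u Du; rewrite (christoffel_ambient Du).
rewrite sum_zero; [|by move=> m; rewrite !chA mul0r..].
by rewrite !chA eqxx /= -/t; field.
Qed.

Lemma riemann_mtmt i : riemann ambient_mx (ix_m i) ix_t (ix_m i) ix_t z = 0.
Proof.
rewrite /riemann sum_ambient pderiv_ch_mmt
  (pd0 (ix_m i) (k := ix_m i) (i := ix_t) (j := ix_t)); last first.
  by move=> u Du; rewrite (christoffel_ambient Du).
under eq_bigr => m _ do rewrite !chA mulr0 sub0r.
rewrite sumrN sum_delta' !chA !eqxx /= -/t; by field.
Qed.

Lemma riemann_rmrt k : riemann ambient_mx ix_r (ix_m k) ix_r ix_t z = 0.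
Proof.
rewrite /riemann sum_ambient (pd0 ix_r (k := ix_r) (i := ix_t) (j := ix_m k)); last first.
  by move=> u Du; rewrite (christoffel_ambient Du).
rewrite (pd0 ix_t (k := ix_r) (i := ix_r) (j := ix_m k)); last first.
  by move=> u Du; rewrite (christoffel_ambient Du).
rewrite sum_zero; [|by move=> m; rewrite !chA mul0r..].
by rewrite !chA /= -/t; field.
Qed.

Lemma riemann_mmmt i k : riemann ambient_mx (ix_m i) (ix_m k) (ix_m i) ix_t z = 0.
Proof.
rewrite /riemann sum_ambient pderiv_ch_mmm_t pderiv_ch_mtm ambient_eqE mulr0 mul0r oppr0.
under eq_bigr => m _ do rewrite !chA.
rewrite sumrB sum_delta sum_delta' !chA -/t; by field.
Qed.

Lemma riemann_tttm j : riemann ambient_mx ix_t ix_t ix_t (ix_m j) z = 0.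
Proof.
rewrite /riemann sum_ambient (pd0 ix_t (k := ix_t) (i := ix_m j) (j := ix_t)); last first.
  by move=> u Du; rewrite (christoffel_ambient Du).
rewrite (pd0 (ix_m j) (k := ix_t) (i := ix_t) (j := ix_t)); last first.
  by move=> u Du; rewrite (christoffel_ambient Du).
rewrite sum_zero; [|by move=> m; rewrite !chA ?mul0r ?mulr0..].
by rewrite !chA; field.
Qed.

Lemma riemann_rtrm j : riemann ambient_mx ix_r ix_t ix_r (ix_m j) z = 0.
Proof.
rewrite /riemann sum_ambient (pd0 ix_r (k := ix_r) (i := ix_m j) (j := ix_t)); last first.
  by move=> u Du; rewrite (christoffel_ambient Du).
rewrite pderiv_ch_rrt ambient_eqE.
rewrite sum_zero; [|by move=> m; rewrite !chA ?mul0r ?mulr0..].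
by rewrite !chA /= -/t; field.
Qed.

Lemma riemann_mtmm i j : riemann ambient_mx (ix_m i) ix_t (ix_m i) (ix_m j) z = 0.
Proof.
rewrite /riemann sum_ambient !pderiv_ch_mmt ambient_eqE mulr0 mul0r oppr0.
under eq_bigr => m _ do rewrite !chA.
rewrite sumrB !sum_delta !chA (slice_christoffel_sym i j i Wz) /= -/t; by field.
Qed.

Lemma riemann_tmtm j k : riemann ambient_mx ix_t (ix_m k) ix_t (ix_m j) z = 0.
Proof.
rewrite /riemann sum_ambient pderiv_ch_tmm
  (pd0 (ix_m j) (k := ix_t) (i := ix_t) (j := ix_m k)); last first.
  by move=> u Du; rewrite (christoffel_ambient Du).
under eq_bigr => m _ do rewrite !chA mul0r sub0r.
rewrite sumrN sum_delta !chA -/t -/w; by field.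
Qed.

Lemma riemann_rmrm j k : riemann ambient_mx ix_r (ix_m k) ix_r (ix_m j) z = 0.
Proof.
rewrite /riemann sum_ambient pderiv_ch_rmm
  (pd0 (ix_m j) (k := ix_r) (i := ix_r) (j := ix_m k)); last first.
  by move=> u Du; rewrite (christoffel_ambient Du).
under eq_bigr => m _ do rewrite !chA z0 !mul0r !sub0r mulNr opprK.
(* Here h (h^-1 h') / 2 = h'/2, which cancels Gamma^rho_{rho t} Gamma^t_jk = - h'_jk / 2. *)
rewrite -/w slice_shapeE // !chA -/t -/w; by field.
Qed.

(** A Gauss equation: besides the curvature of the slice there are the products of Christoffel
    symbols whose summed index is t, which give the terms h'/2, and those where it is rho, which
    give the [slice_shape] terms. *)
Lemma riemann_mmmm i j k : riemann ambient_mx (ix_m i) (ix_m k) (ix_m i) (ix_m j) z =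
  riemann (F \o row_mx 0) i k i j y - 2^-1 * slice_dr j k w
  + (i == j)%:R * (2^-1 * slice_dr i k w)
  - slice_shape i i w * F w j k + F w k i * slice_shape i j w.
Proof.
rewrite /riemann sum_ambient !pderiv_ch_mmm !chA z0 -/t -/w eqxx.
under eq_bigr => m _ do rewrite !chA.
have Fs : F w i k = F w k i by move/matrixP: (F_sym Wz) => /(_ k i); rewrite mxE.
have -> : \sum_m (slice_christoffel i i m w * slice_christoffel m j k w -
    slice_christoffel i j m w * slice_christoffel m i k w) =
   \sum_m (christoffel (F \o row_mx 0) i i m y * christoffel (F \o row_mx 0) m j k y -
    christoffel (F \o row_mx 0) i j m y * christoffel (F \o row_mx 0) m i k y).
  by apply: eq_bigr => m _; rewrite origin_slice -!slice_christoffel_zero.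
rewrite Fs; move: (\sum_m _) (pderiv i _ y) (pderiv j _ y) => S A B.
rewrite /=; by field.
Qed.

Lemma ricci_ambient_tt : ricci_mx ambient_mx z ix_t ix_t = 0.
Proof.
rewrite mxE sum_ambient riemann_diag riemann_rtrt big1 ?addr0 // => i _.
exact: riemann_mtmt.
Qed.

Lemma ricci_ambient_tm k : ricci_mx ambient_mx z ix_t (ix_m k) = 0.
Proof.
rewrite mxE sum_ambient riemann_diag riemann_rmrt big1 ?addr0 // => i _.
exact: riemann_mmmt.
Qed.

Lemma ricci_ambient_mt j : ricci_mx ambient_mx z (ix_m j) ix_t = 0.
Proof.
rewrite mxE sum_ambient riemann_tttm riemann_rtrm big1 ?addr0 // => i _.
exact: riemann_mtmm.
Qed.

Definition slice_dr_mx : 'M[R]_n := \matrix_(i, j) slice_dr i j w.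

(** In the sum over i of [riemann_mmmm], the multiples of h' are - n/2 from the constant term, 1/2
    from the Kronecker term and 1/2 from [slice_shapeE]: together - (n - 2)/2. The diagonal of
    [slice_shape] sums to half the trace. *)
Lemma ricci_ambient_mm j k : ricci_mx ambient_mx z (ix_m j) (ix_m k) =
  ricci_mx (F \o row_mx 0) y j k - (n%:R - 2) / 2 * slice_dr j k w
  - \tr (invmx (F w) *m slice_dr_mx) / 2 * F w j k.
Proof.
rewrite mxE sum_ambient riemann_tmtm riemann_rmrm !add0r.
(* Naming the slice curvature keeps it atomic while the sum is split. *)
have [Rs ERs] : exists Rs : 'I_n -> R, forall i, riemann (F \o row_mx 0) i k i j y = Rs i.
  by eexists => i; reflexivity.
under eq_bigr do rewrite riemann_mmmm ERs.
rewrite !(big_split, sumrB, sumrN) /= slice_shapeE // sumr_const card_ord.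
rewrite [X in _ = X - _ - _]mxE.
rewrite [in RHS](eq_bigr _ (fun i _ => ERs i)).
have -> : \sum_i (i == j)%:R * (2^-1 * slice_dr i k w) = 2^-1 * slice_dr j k w.
  rewrite (bigD1 j) //= eqxx mul1r big1 ?addr0 // => i /negbTE ->.
  by rewrite mul0r.
have -> : \sum_i slice_shape i i w * F w j k =
    \tr (invmx (F w) *m slice_dr_mx) / 2 * F w j k.
  rewrite -mulr_suml; congr (_ * _); rewrite mulrC -mulr_sumr; congr (_ * _).
  apply: eq_bigr => i _; rewrite !mxE; apply: eq_bigr => l _.
  by rewrite mxE (slice_dr_sym i l Wz).
rewrite (slice_dr_sym k j Wz) -[_ *+ n]mulr_natl.
move: (slice_dr j k w) (\tr _) (F w j k) (\sum_i Rs i) => a b c d.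
by field.
Qed.

End AtOrigin.

End AmbientCoordinates.

(** * Charts and vector fields *)

Section Jacobians.
Context {R : realType}.

Lemma jacobian_comp m n p (f : 'rV[R]_m -> 'rV[R]_n) (g : 'rV[R]_n -> 'rV[R]_p) x :
  differentiable f x -> differentiable g (f x) ->
  jacobian (g \o f) x = jacobian f x *m jacobian g (f x).
Proof.
move=> df dg; have dgf := differentiable_comp df dg.
apply/row_matrixP => i; rewrite [LHS]rowE [RHS]rowE mulmxA.
rewrite -(deriveEjacobian _ dgf) -(deriveEjacobian _ df) -(deriveEjacobian _ dg).
by rewrite (deriveE _ dgf) (deriveE _ dg) (deriveE _ df) diff_comp.
Qed.

Lemma near_eq_jacobian m n (f g : 'rV[R]_m -> 'rV[R]_n) x :
  {near x, f =1 g} -> differentiable f x -> jacobian f x = jacobian g x.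
Proof.
move=> fg df; have dg := near_eq_differentiable fg df.
apply/row_matrixP => i; rewrite [LHS]rowE [RHS]rowE.
transitivity ('D_(delta_mx 0 i) f x); first exact/esym/deriveEjacobian.
transitivity ('D_(delta_mx 0 i) g x); last exact: deriveEjacobian.
exact: near_eq_derive.
Qed.

Lemma jacobian_id m (x : 'rV[R]_m) : jacobian id x = 1%:M.
Proof.
apply/row_matrixP => i; rewrite [LHS]rowE [RHS]rowE mulmx1 -(deriveEjacobian _ (ex_diff (f := id))).
by rewrite derive_id.
Qed.

End Jacobians.

Section Charts.
Context {R : realType} {n : nat} (M : charted_space R n).
Hypothesis hM : smooth_manifold M.
Implicit Types (i j k : cidx M) (x : M).

Lemma chart_exists x : exists i, chart_dom i x.
Proof.
have [_ _ cM _ _] := hM; have : [set: M] x by [].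
by rewrite -cM => -[i _ Mix]; exists i.
Qed.

Lemma open_cod i : open (cod i).
Proof. by have [_ _ _ H _] := hM; have [] := H i. Qed.

Lemma open_chart i : open (chart_dom i).
Proof. by have [_ _ _ H _] := hM; have [] := H i. Qed.

Lemma crdK i x : chart_dom i x -> cpt i (crd i x) = x.
Proof. by have [_ _ _ H _] := hM; have [_ _ + _ _] := H i => + ix; apply; rewrite inE. Qed.

Lemma cpt_continuous i y : cod i y -> {for y, continuous (cpt i)}.
Proof. by have [_ _ _ H _] := hM; have [_ _ _ _ +] := H i => + iy; apply; rewrite inE. Qed.

Lemma crd_cod i x : chart_dom i x -> cod i (crd i x).
Proof. by exists x. Qed.

Lemma cptK i y : cod i y -> crd i (cpt i y) = y.
Proof. by move=> [x ix <-]; rewrite crdK. Qed.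

Lemma cpt_dom i y : cod i y -> chart_dom i (cpt i y).
Proof. by move=> [x ix <-]; rewrite crdK. Qed.

Lemma open_cod_preimage i (A : set M) : open A -> open [set y | cod i y /\ A (cpt i y)].
Proof.
move=> oA; rewrite openE => y [iy Ay]; apply: filterI.
  by apply: open_nbhs_nbhs; split=> //; exact: open_cod.
by apply: (cpt_continuous iy); exact: open_nbhs_nbhs.
Qed.

Lemma overlapE i j : crd i @` (chart_dom i `&` chart_dom j) =
  [set y | cod i y /\ chart_dom j (cpt i y)].
Proof.
apply/seteqP; split=> y /=; first by move=> [x [ix jx] <-]; rewrite crdK //; split=> //; exists x.
by move=> [iy jy]; exists (cpt i y); [split=> //; exact: cpt_dom|exact: cptK].
Qed.

Lemma open_overlap i j : open (crd i @` (chart_dom i `&` chart_dom j)).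
Proof. by rewrite overlapE; apply: open_cod_preimage; exact: open_chart. Qed.

Lemma smooth_transition i j : smooth_on (crd i @` (chart_dom i `&` chart_dom j)) (transition i j).
Proof. by have [_ _ _ _ H] := hM. Qed.

Lemma differentiable_transition i j x : chart_dom i x -> chart_dom j x ->
  differentiable (transition i j) (crd i x).
Proof. by move=> ix jx; apply: (smooth_on_differentiable (@smooth_transition i j)); exists x. Qed.

Lemma near_crd i x (A : set M) : chart_dom i x -> open A -> A x ->
  \forall y \near crd i x, cod i y /\ A (cpt i y).
Proof.
move=> ix oA Ax; apply: (@open_nbhs_nbhs _ (crd i x)); split; first exact: open_cod_preimage.
by split; [exact: crd_cod|rewrite crdK].
Qed.

Lemma transitionE i j x : chart_dom i x -> transition i j (crd i x) = crd j x.
Proof. by move=> ix; rewrite /transition /= crdK. Qed.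

Lemma jac_chain i j k x : chart_dom i x -> chart_dom j x -> chart_dom k x ->
  jac i k x = jac i j x *m jac j k x.
Proof.
move=> ix jx kx; rewrite /jac -[in 'J (transition j k) _](transitionE j ix).
rewrite -jacobian_comp; first last.
- by rewrite transitionE //; exact: differentiable_transition.
- exact: differentiable_transition.
apply: near_eq_jacobian; last exact: differentiable_transition.
near=> y; have [iy jy] : cod i y /\ chart_dom j (cpt i y).
  by near: y; apply: near_crd => //; exact: open_chart.
by rewrite /transition /= crdK.
Unshelve. all: by end_near. Qed.

Lemma jac_id i x : chart_dom i x -> jac i i x = 1%:M.
Proof.
move=> ix; rewrite -(jacobian_id (crd i x)); apply: near_eq_jacobian.
  near=> y; rewrite /transition /= cptK //; near: y.
  by apply: open_nbhs_nbhs; split; [exact: open_cod|exact: crd_cod].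
exact: differentiable_transition.
Unshelve. all: by end_near. Qed.

(** A bump times a constant vector in chart i, extended by 0. The image K of a closed ball is
    compact, hence closed as M is Hausdorff; so every point has a neighbourhood inside chart i or
    disjoint from K, and the field is smooth on both kinds. *)
Lemma vector_field_extension i (x0 : M) (v : 'rV[R]_n) : chart_dom i x0 ->
  exists2 X : components M 'rV[R]_n, vector_field X & X i x0 = v.
Proof.
move=> ix0; pose c := crd i x0.
have [r r0 Br] : exists2 r, 0 < r & closed_ball c r `<=` cod i.
  have : nbhs c (cod i) by apply: open_nbhs_nbhs; split; [exact: open_cod|exact: crd_cod].
  by move=> /(nbhs_closedballP) [r Hr]; exists r%:num.
pose K := cpt i @` closed_ball c r.
have clK : closed K.
  have [hausM _ _ _ _] := hM; apply: compact_closed => //.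
  apply: continuous_compact.
    apply: continuous_in_subspaceT => y; rewrite inE => cy.
    exact/cpt_continuous/Br.
  apply: bounded_closed_compact; last exact: closed_ball_closed.
  rewrite closed_ballE //; exists (`|c| + r); split; first exact: num_real.
  move=> x xr y cy; apply: le_trans (ltW xr).
  by rewrite -[y](subrK c) addrC (le_trans (ler_normD _ _)) // lerD2l distrC.
have Ki x : K x -> chart_dom i x by move=> [y /Br /cpt_dom iy <-].
have [phi [sphi phic] phir] := smooth_bump c r0.
pose w := (phi c)^-1 *: v.
pose X : components M 'rV[R]_n := fun k x =>
  if `[<chart_dom i x>] then phi (crd i x) *: (w *m jac i k x) else 0.
exists X; last by rewrite /X asboolT // jac_id // mulmx1 scalerA divff // scale1r.
split=> [k|k l x kx lx]; last first.
  rewrite /X; case: asboolP => ix; last by rewrite mul0mx.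
  by rewrite -scalemxAl -mulmxA -jac_chain.
apply: smooth_on_locally => y ky; pose x := cpt k y; have kx : chart_dom k x by exact: cpt_dom.
have [ix|nix] := pselect (chart_dom i x).
  exists (crd k @` (chart_dom k `&` chart_dom i)).
    by split; [exact: open_overlap|exists x => //; rewrite cptK].
  have oU := @open_overlap k i; have oV := @open_overlap i k.
  have UV z : (crd k @` (chart_dom k `&` chart_dom i)) z ->
      (crd i @` (chart_dom i `&` chart_dom k)) (transition k i z).
    by move=> [p [kp ip] <-]; exists p => //; rewrite transitionE.
  (* Near a point of chart i the field, read in chart k, is pulled back along the transition from k
     to i. *)
  apply: (@smooth_on_eq _ _ _ _ (fun z => phi (transition k i z) *:
      (w *m jacobian (transition i k) (transition k i z)))) => //.
    move=> _ [p [kp ip] <-]; rewrite (transitionE i kp).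
    by rewrite -[RHS]/(X k (cpt k (crd k p))) (crdK kp) /X (asboolT ip).
  apply: smooth_on_mx => // a b.
  apply: (@smooth_on_eq _ _ _ _ (fun z => phi (transition k i z) *
      (w *m jacobian (transition i k) (transition k i z)) a b)) => //.
    by move=> z _; rewrite [RHS]mxE.
  apply: smooth_on_mul => //.
    by apply: (smooth_on_comp_rV oU _ sphi (@smooth_transition k i)).
  apply: smooth_on_entry => //; apply: smooth_on_mulmx => //; first exact: smooth_on_cst.
  apply: (smooth_on_comp_mx oU oV UV _ (@smooth_transition k i)).
  exact/smooth_on_jacobian/smooth_transition.
(* Off K the field vanishes, also at points of chart i, because there the bump is 0 outside the
   ball. *)
exists [set z | cod k z /\ (~` K) (cpt k z)].
  split; first by apply: open_cod_preimage; exact: closed_openC.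
  by split=> // /Ki.
apply: (@smooth_on_eq _ _ _ _ (cst 0)); [|  |exact: smooth_on_cst].
  by apply: open_cod_preimage; exact: closed_openC.
move=> z [kz Kz]; rewrite /X /=; case: asboolP => // iz.
case: (eqVneq (phi (crd i (cpt k z))) 0) => [->|]; first by rewrite scale0r.
move=> /phir H; exfalso; apply: Kz; exists (crd i (cpt k z)); last by rewrite crdK.
by apply: subset_closed_ball; rewrite -ball_normE /= distrC.
Qed.

End Charts.

(** * The scale bundle *)

Section AffineJacobians.
Context {R : realType}.

Lemma linear_mulmxr m n (B : 'M[R]_(m, n)) : linear (fun z : 'rV[R]_m => z *m B).
Proof. by move=> a u v; rewrite mulmxDl scalemxAl. Qed.

Lemma continuous_mulmxr m n (B : 'M[R]_(m, n)) : continuous (fun z : 'rV[R]_m => z *m B).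
Proof.
move=> z; apply: differentiable_continuous.
have oT := @openT 'rV[R]_m.
apply: (@smooth_on_differentiable _ _ _ setT) => //.
apply: smooth_on_mulmx => //; last exact: smooth_on_cst.
by apply: (@smooth_on_linear _ _ _ setT id) => // y.
Qed.

Lemma jacobian_mulmxr m n (B : 'M[R]_(m, n)) z : jacobian (fun z : 'rV[R]_m => z *m B) z = B.
Proof.
have dB := differentiable_linear z (linear_mulmxr B) (@continuous_mulmxr _ _ B).
apply/row_matrixP => i; rewrite [LHS]rowE [RHS]rowE -(deriveEjacobian _ dB).
by rewrite derive_linear //; [exact: linear_mulmxr|exact: continuous_mulmxr].
Qed.

Lemma jacobianD m n (f h : 'rV[R]_m -> 'rV[R]_n) z : differentiable f z -> differentiable h z ->
  jacobian (f + h) z = jacobian f z + jacobian h z.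
Proof.
move=> df dh; apply/row_matrixP => i; rewrite [LHS]rowE [RHS]rowE mulmxDr.
transitivity ('D_(delta_mx 0 i) (f + h) z); first exact/esym/deriveEjacobian/differentiableD.
rewrite deriveD; [|exact: diff_derivable..].
by congr (_ + _); exact: deriveEjacobian.
Qed.

(** Fits the chart changes of the scale bundle and its embedding, which act on t by a copy and on x
    by a transition map: B1 copies t, B2 projects to x, B3 includes the result. The formula is only
    local since the inverse charts of the bundle are meaningful for t > 0. *)
Lemma jacobian_affine m n p q (B1 : 'M[R]_(m, q)) (B2 : 'M[R]_(m, n)) (B3 : 'M[R]_(p, q))
    (tau : 'rV[R]_n -> 'rV[R]_p) (f : 'rV[R]_m -> 'rV[R]_q) z :
  differentiable tau (z *m B2) ->
  {near z, f =1 fun z => z *m B1 + tau (z *m B2) *m B3} ->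
  jacobian f z = B1 + B2 *m jacobian tau (z *m B2) *m B3.
Proof.
move=> dtau fE.
have dB a b (B : 'M[R]_(a, b)) y : differentiable (fun z : 'rV[R]_a => z *m B) y.
  by apply: differentiable_linear; [exact: linear_mulmxr|exact: continuous_mulmxr].
pose f2 := tau \o (fun z : 'rV[R]_m => z *m B2).
have df2 : differentiable f2 z by exact: differentiable_comp.
pose f3 := (fun z : 'rV[R]_p => z *m B3) \o f2.
have df3 : differentiable f3 z by apply: differentiable_comp => //; exact: dB.
have E : jacobian ((fun z : 'rV[R]_m => z *m B1) + f3) z =
    B1 + B2 *m jacobian tau (z *m B2) *m B3.
  rewrite jacobianD // jacobian_mulmxr; congr (_ + _).
  rewrite /f3 (jacobian_comp df2 (dB _ _ B3 _)) jacobian_mulmxr; congr (_ *m _).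
  by rewrite /f2 (jacobian_comp (dB _ _ B2 _) dtau) jacobian_mulmxr.
rewrite -E; apply/esym/near_eq_jacobian; last exact: differentiableD.
by apply: filterS fE => y ->.
Qed.

Lemma rsubmx_mulmx n (z : 'rV[R]_(1 + n)) : rsubmx z = z *m col_mx 0 1%:M.
Proof. by rewrite -[in RHS](hsubmxK z) mul_row_col mulmx0 add0r mulmx1. Qed.

End AffineJacobians.

Section BilinearForms.
Context {R : realType} {n : nat}.
Implicit Types (h : 'M[R]_n) (v w : 'rV[R]_n).

Lemma bilinZ (a : R) h v w : bilin (a *: h) v w = a * bilin h v w.
Proof. by rewrite /bilin -scalemxAr -scalemxAl mxE. Qed.

Lemma bilin_eq0 h : (forall v w, bilin h v w = 0) -> h = 0.
Proof.
move=> h0; apply/matrixP => i j; have := h0 (delta_mx 0 i) (delta_mx 0 j).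
by rewrite /bilin -rowE trmx_delta -colE !mxE.
Qed.

Lemma bilinB h h' v w : bilin (h - h') v w = bilin h v w - bilin h' v w.
Proof. by rewrite /bilin mulmxBr mulmxBl [LHS]mxE [X in _ + X]mxE. Qed.

Lemma bilin_inj h h' : (forall v w, bilin h v w = bilin h' v w) -> h = h'.
Proof.
move=> hh; apply/eqP; rewrite -subr_eq0; apply/eqP/bilin_eq0 => v w.
by rewrite bilinB hh subrr.
Qed.

Lemma bilin_tr h v w : bilin h^T v w = bilin h w v.
Proof.
have E : v *m h^T *m w^T = (w *m h *m v^T)^T by rewrite !trmx_mul trmxK mulmxA.
by rewrite /bilin E mxE.
Qed.

Lemma bilinE m (h : 'M[R]_m) (v w : 'rV[R]_m) : bilin h v w = \sum_j (\sum_i v 0 i * h i j) * w 0 j.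
Proof. by rewrite /bilin mxE; apply: eq_bigr => j _; rewrite !mxE. Qed.

(** Vectors tangent to the scale bundle have no rho component, so only the t and M entries of h
    enter. *)
Lemma bilin_ambient (h : 'M[R]_(1 + (1 + n))) (S : 'M[R]_n) (a b : 'rV[R]_1) v w :
  h (ix_t) (ix_t) = 0 -> (forall k, h ix_t (ix_m k) = 0) -> (forall k, h (ix_m k) ix_t = 0) ->
  (forall j k, h (ix_m j) (ix_m k) = S j k) ->
  bilin h (row_mx a (row_mx 0 v)) (row_mx b (row_mx 0 w)) = bilin S v w.
Proof.
move=> h00 h0m hm0 hmm; rewrite !bilinE.
have vt (c : 'rV[R]_1) u : row_mx c (row_mx 0 u) 0 ix_t = c 0 0 :> R by rewrite row_mxEl.
have vr (c : 'rV[R]_1) (u : 'rV[R]_n) : row_mx c (row_mx 0 u) 0 ix_r = 0 :> R.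
  by rewrite row_mxEr row_mxEl mxE.
have vm (c : 'rV[R]_1) (u : 'rV[R]_n) k : row_mx c (row_mx 0 u) 0 (ix_m k) = u 0 k :> R.
  by rewrite !row_mxEr.
rewrite sum_ambient vr mulr0 add0r sum_ambient vt vr h00 mulr0 mul0r !add0r.
rewrite [X in X * _]big1 => [|k _]; last by rewrite hm0 mulr0.
rewrite mul0r add0r; apply: eq_bigr => j _; rewrite vm sum_ambient vt vr h0m mulr0 mul0r !add0r.
by congr (_ * _); apply: eq_bigr => k _; rewrite vm hmm.
Qed.

End BilinearForms.

Section ScaleBundle.
Context {R : realType} {n : nat} (hn : (2 <= n)%N) (M : charted_space R n).
Hypothesis hM : smooth_manifold M.
Variable c : set (components M 'M[R]_n).
Hypothesis hc : conformal_structure c.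
Variable g : components M 'M[R]_n.
Hypothesis cg : c g.

Lemma metric_in_class : riemannian_metric g.
Proof. by have [g0 _ E] := hc; move: cg; rewrite E => -[]. Qed.

Lemma metric_neq0 i x : chart_dom i x -> g i x != 0.
Proof.
move=> ix; have [_ /(_ i x ix) [_ pos]] := metric_in_class.
apply/eqP => g0; have := pos (const_mx 1); rewrite g0.
have -> : bilin (0 : 'M[R]_n) (const_mx 1) (const_mx 1) = 0.
  by rewrite /bilin mulmx0 mul0mx mxE.
rewrite ltxx => H; suff : false by []; apply: H.
(* The constant vector 1 is nonzero because the dimension is positive. *)
case: n hn => [//|m _]; apply/eqP => /matrixP/(_ 0 0); rewrite !mxE.
by move/eqP; rewrite oner_eq0.
Qed.

(** Adding ln t to the conformal exponent u multiplies the metric by t^2. This makes t^2 g_x a point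
    of the bundle for every t > 0. *)
Lemma class_scale (t : R) : 0 < t -> c (fun i x => t ^+ 2 *: g i x).
Proof.
move=> t0; have [g0 rg0 E] := hc; move: (cg); rewrite E /= => -[[[sg gtr] gpos] [u su gu]].
split; last first.
  exists (fun x => u x + ln t).
    move=> i; apply: (@smooth_on_add _ _ _ _ (u \o cpt i) (cst (ln t))).
    - exact: open_cod.
    - exact: su.
    exact: smooth_on_cst.
  move=> i x ix; rewrite gu // scalerA mulrDr expRD mulrC [expR (2 * ln t)]expRM_natl lnK //.
split; first split.
- by move=> i; apply: (@smooth_on_scale _ _ _ _ (g i \o cpt i)); [exact: open_cod|exact: sg].
- by move=> i j x ix jx; rewrite (gtr i j) // -scalemxAr -scalemxAl.
move=> i x ix; have [gs gp] := gpos i x ix; split=> [v w|v v0].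
  by rewrite !bilinZ gs.
by rewrite bilinZ mulr_gt0 ?exprn_gt0 ?gp.
Qed.

Lemma value_at_scale (t : R) x :
  value_at (fun i x => t ^+ 2 *: g i x) x = fun i => t ^+ 2 *: value_at g x i.
Proof. by apply/funext => i; rewrite /value_at; case: asboolP => // _; rewrite scaler0. Qed.

Lemma scale_factor_eq (q : scale_point c) (t : R) : 0 < t ->
  point_form q = (fun i => t ^+ 2 *: value_at g (point_foot q) i) -> scale_factor g q = t.
Proof.
move=> t0 qt; apply: xget_unique => // s [s0]; rewrite qt => E.
have [i ix] := chart_exists hM (point_foot q).
move/funeqP: E => /(_ i); rewrite /value_at asboolT // => /eqP.
rewrite -subr_eq0 -scalerBl scaler_eq0 (negbTE (metric_neq0 ix)) orbF subr_eq0.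
by rewrite eqrXn2 ?ltW // => /eqP.
Qed.

Lemma scale_factor_gt0 (q : scale_point c) : 0 < scale_factor g q.
(* The default value 1 of [xget] is positive too. *)
Proof. by rewrite /scale_factor; case: xgetP => [t _ []|]. Qed.

Let Q := scale_bundle cg.

Lemma foot_cpt (k : cidx Q) z : point_foot (cpt k z : scale_point c) = cpt (k : cidx M) (rsubmx z).
(* The default value [section_at] has the same foot, so this holds for every z. *)
Proof. by rewrite /=; case: xgetP => [q _ []|]. Qed.

Lemma scale_factor_cpt (k : cidx Q) z : 0 < lsubmx z 0 0 ->
  scale_factor g (cpt k z : scale_point c) = lsubmx z 0 0.
Proof.
move=> t0; apply: scale_factor_eq => //; rewrite foot_cpt /=.
set x := cpt _ _; set P := [set q | _].
have [q Pq] : exists q, P q.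
  have H : exists2 g', c g' & (fun i => lsubmx z 0 0 ^+ 2 *: value_at g x i) = value_at g' x.
    by exists (fun i x => lsubmx z 0 0 ^+ 2 *: g i x); [exact: class_scale|rewrite value_at_scale].
  by exists (Scale H).
by have [_] := xgetI (section_at cg x) Pq.
Qed.

Lemma crd_scale_bundle (k : cidx Q) (q : Q) :
  crd k q = row_mx (const_mx (scale_factor g q)) (crd (k : cidx M) (point_foot q)).
Proof. by []. Qed.

Lemma near_lsubmx_gt0 m (z : 'rV[R]_(1 + m)) : 0 < lsubmx z 0 0 ->
  \forall y \near z, 0 < lsubmx y 0 0.
Proof.
move=> z0; apply: (@open_nbhs_nbhs _ z [set y | 0 < lsubmx y 0 0]); split=> //.
apply: (@open_comp _ _ (fun z : 'rV[R]_(1 + m) => lsubmx z 0 0) [set t | 0 < t]).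
  move=> y _; rewrite (_ : (fun _ => _) = (fun z : 'rV[R]_(1 + m) => z 0 (lshift m 0))).
    exact: coord_continuous.
  by apply/funext => u; rewrite mxE.
exact: open_gt.
Qed.

(** The coordinate t comes from the global section g and is common to all charts. *)
Lemma jac_scale_bundle (k l : cidx Q) (q : Q) : chart_dom k q -> chart_dom l q ->
  jac k l q = block_mx 1%:M 0 0 (jac (k : cidx M) (l : cidx M) (point_foot q)).
Proof.
move=> kq lq; set z := crd k q.
have rz : z *m col_mx 0 1%:M = crd (k : cidx M) (point_foot q).
  by rewrite -rsubmx_mulmx /z crd_scale_bundle row_mxKr.
rewrite /jac (@jacobian_affine _ _ n n _ (block_mx 1%:M 0 0 0) (col_mx 0 1%:M) (row_mx 0 1%:M)
  (transition (k : cidx M) (l : cidx M))).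
- rewrite rz mul_col_mx mul0mx mul1mx mul_col_row !mulmx0 mul0mx mulmx1.
  by rewrite add_block_mx !addr0 !add0r.
- by rewrite rz; exact: differentiable_transition.
have : 0 < lsubmx z 0 0 by rewrite /z crd_scale_bundle row_mxKl mxE scale_factor_gt0.
move/near_lsubmx_gt0; apply: filterS => y y0.
rewrite -rsubmx_mulmx [LHS]crd_scale_bundle scale_factor_cpt // foot_cpt.
rewrite -[X in X *m block_mx _ _ _ _](hsubmxK y) mul_row_block !mulmx0 mulmx1 !addr0.
rewrite mul_mx_row mulmx0 mulmx1 add_row_mx addr0 add0r; congr row_mx.
by apply/rowP => i; rewrite (ord1 i) !mxE.
Qed.

(** Supplies the vector fields on the bundle that test flatness; a constant t component is
    compatible with the block form of [jac_scale_bundle]. *)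
Lemma lift_vector_field (T : R) (X : components M 'rV[R]_n) : vector_field X ->
  vector_field (fun (k : cidx Q) (q : Q) =>
    row_mx (const_mx T) (X k (point_foot q)) : 'rV[R]_(1 + n)).
Proof.
move=> [sX trX]; split=> [k|k l q kq lq]; last first.
  rewrite jac_scale_bundle // mul_row_block !mulmx0 mulmx1 addr0 add0r.
  by rewrite -(trX k l).
pose U := [set z : 'rV[R]_(1 + n) | cod (k : cidx M) (rsubmx z)].
have oU : open U.
  apply: (@open_comp _ _ (rsubmx : 'rV[R]_(1 + n) -> 'rV[R]_n)); last exact: (open_cod hM).
  by move=> z _; exact: continuous_rsubmx.
apply: (@smooth_on_sub _ _ _ U).
  by move=> _ [q kq <-]; rewrite /U /= row_mxKr; exact: crd_cod.
apply: (@smooth_on_eq _ _ _ _ (fun z => row_mx (const_mx T) 0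
    + X k (cpt (k : cidx M) (rsubmx z)) *m row_mx 0 1%:M)) => //.
  move=> z _; rewrite mul_mx_row mulmx0 mulmx1 add_row_mx addr0 add0r.
  by rewrite -foot_cpt.
apply: (@smooth_on_add _ _ _ _ (cst _)) => //; first exact: smooth_on_cst.
apply: smooth_on_mulmx => //; last exact: smooth_on_cst.
apply: (@smooth_on_comp_linear _ _ _ _ _ (X k \o cpt (k : cidx M)) rsubmx).
- exact: linearP.
- exact: continuous_rsubmx.
exact: sX.
Qed.

(** In charts, for t > 0, the embedding reads (t, x) -> (t, 0, tau x) with tau a transition map of
    M. *)
Lemma tangent_scale_embedding (delta : R) (d0 : 0 < delta) (xi : components Q 'rV[R]_(1 + n))
    (k : cidx Q) (l : cidx (ambient M d0)) (q : Q) :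
  chart_dom k q -> chart_dom l (scale_embedding cg d0 q) ->
  tangent_map (scale_embedding cg d0) xi k l q =
  row_mx (lsubmx (xi k q)) (row_mx 0 (rsubmx (xi k q) *m jac (k : cidx M) l.2.2 (point_foot q))).
Proof.
move=> kq [_ [_ /= lq]]; set z := crd k q.
have rz : z *m col_mx 0 1%:M = crd (k : cidx M) (point_foot q).
  by rewrite -rsubmx_mulmx /z crd_scale_bundle row_mxKr.
rewrite /tangent_map (@jacobian_affine _ _ n n _ (block_mx 1%:M 0 0 0) (col_mx 0 1%:M)
  (row_mx 0 (row_mx 0 1%:M)) (transition (k : cidx M) l.2.2)).
- rewrite rz mul_col_mx mul0mx mul1mx mul_col_row !mul_mx_row !mulmx0 mulmx1 row_mx0.
  rewrite add_block_mx !addr0 !add0r -[X in X *m _]hsubmxK mul_row_block.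
  by rewrite !mulmx1 !mulmx0 addr0 add0r mul_mx_row mulmx0.
- by rewrite rz; exact: differentiable_transition.
have : 0 < lsubmx z 0 0 by rewrite /z crd_scale_bundle row_mxKl mxE scale_factor_gt0.
move/near_lsubmx_gt0; apply: filterS => y y0.
rewrite -rsubmx_mulmx -[X in X *m block_mx _ _ _ _](hsubmxK y) mul_row_block.
rewrite !mulmx0 mulmx1 !addr0 !mul_mx_row !mulmx0 mulmx1 add_row_mx addr0 add0r.
rewrite [LHS]/= foot_cpt scale_factor_cpt //.
rewrite insubdK ?inE //; congr row_mx.
by apply/rowP => i; rewrite (ord1 i) !mxE.
Qed.

End ScaleBundle.

(** * The ambient Ricci tensor along the scale bundle *)

Section AmbientRicci.
Context {R : realType} {n : nat} (hn : (2 <= n)%N) (M : charted_space R n).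
Hypothesis hM : smooth_manifold M.
Variable c : set (components M 'M[R]_n).
Hypothesis hc : conformal_structure c.
Variable g : components M 'M[R]_n.
Hypothesis cg : c g.

Let rg := metric_in_class hc cg.

Lemma metric_sym i x : chart_dom i x -> (g i x)^T = g i x.
Proof.
move=> ix; have [_ /(_ i x ix) [gs _]] := rg.
by apply: bilin_inj => v w; rewrite bilin_tr.
Qed.

(** A nonzero vector in the kernel would have length 0. *)
Lemma metric_unit i x : chart_dom i x -> g i x \in unitmx.
Proof.
move=> ix; have [_ /(_ i x ix) [_ gp]] := rg.
rewrite -row_free_unit -kermx_eq0; apply/negPn/negP => k0.
have := gp (nz_row (kermx (g i x))); rewrite nz_row_eq0 => /(_ k0).
have /sub_kermxP E := nz_row_sub (kermx (g i x)).
by rewrite /bilin E mul0mx mxE ltxx.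
Qed.

Lemma smooth_metric i : smooth_on (cod i) (g i \o cpt i).
Proof. by have [[sg _] _] := rg. Qed.

Lemma ricci_surface i x : n = 2%N -> chart_dom i x ->
  Ric g i x = gauss_curvature g i x *: g i x.
Proof.
move=> n2 ix; have -> : g i x = (g i \o cpt i) (crd i x) by rewrite /= crdK.
have oU := @open_cod _ _ _ hM i.
have sG := @smooth_metric i.
have Gs z : cod i z -> ((g i \o cpt i) z)^T = (g i \o cpt i) z.
  by move=> iz; apply: metric_sym; exact: cpt_dom.
have Gu z : cod i z -> (g i \o cpt i) z \in unitmx.
  by move=> iz; apply: metric_unit; exact: cpt_dom.
rewrite /Ric /gauss_curvature.
have iy := crd_cod ix.
(* Whatever depends on n is generalised, so that n can become 2 inside the types. *)
move: (g i \o cpt i) (crd i x) (cod i) oU sG Gs Gu iy => G y U.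
move: G y U; rewrite n2 => G y U oU sG Gs Gu Uy.
exact: (ricci_gauss oU sG Gs Gu Uy).
Qed.

Variable alpha : R -> components M 'M[R]_n.
Hypothesis halpha : admissible c alpha.
Variables (delta : R) (d0 : 0 < delta).
Hypothesis hdelta : nonsingular_within delta alpha.

Section InChart.
Variable i : cidx M.

Definition slices (w : 'rV[R]_(1 + n)) : 'M[R]_n :=
  lowered g (alpha (lsubmx w 0 0)) i (cpt i (rsubmx w)).

Definition slices_dom : set 'rV[R]_(1 + n) :=
  [set w | `|lsubmx w 0 0| < delta /\ cod i (rsubmx w)].

Lemma open_cod_rsubmx : open [set w : 'rV[R]_(1 + n) | cod i (rsubmx w)].
Proof.
apply: (@open_comp _ _ (rsubmx : 'rV[R]_(1 + n) -> 'rV[R]_n)); last exact: (open_cod hM).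
by move=> z _; exact: continuous_rsubmx.
Qed.

Lemma open_slices_dom : open slices_dom.
Proof.
apply: openI; last exact: open_cod_rsubmx.
apply: (@open_comp _ _ (fun w : 'rV[R]_(1 + n) => `|lsubmx w 0 0|) [set t | t < delta]).
  move=> w _; apply: (@continuous_comp _ _ _ (fun w : 'rV[R]_(1 + n) => lsubmx w 0 0) Num.norm).
    rewrite (_ : (fun _ => _) = (fun z : 'rV[R]_(1 + n) => z 0 (lshift n 0))).
      exact: coord_continuous.
    by apply/funext => u; rewrite mxE.
  exact: norm_continuous.
exact: open_lt.
Qed.

Let smooth_alpha : smooth_on [set w : 'rV[R]_(1 + n) | cod i (rsubmx w)]
   (fun w => alpha (lsubmx w 0 0) i (cpt i (rsubmx w))).
Proof. by have [[_ H] _ _ _] := halpha. Qed.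

Lemma smooth_slices : smooth_on slices_dom slices.
Proof.
apply: (@smooth_on_sub _ _ _ [set w : 'rV[R]_(1 + n) | cod i (rsubmx w)]).
  by move=> w [].
apply: smooth_on_mulmx => //; first exact: open_cod_rsubmx.
apply: (@smooth_on_comp_linear _ _ _ _ _ (g i \o cpt i) rsubmx).
- exact: linearP.
- exact: continuous_rsubmx.
exact: smooth_metric.
Qed.

(** This is the self-adjointness of alpha with respect to g. *)
Lemma slices_sym w : slices_dom w -> (slices w)^T = slices w.
Proof.
move=> [_ /(cpt_dom hM) ix]; rewrite /slices /lowered.
have [_ /(_ (lsubmx w 0 0) g cg i _ ix) sa _ _] := halpha.
rewrite trmx_mul metric_sym //; apply: bilin_inj => v u.
by rewrite /bilin !mulmxA; have := sa v u; rewrite /bilin trmx_mul !mulmxA => ->.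
Qed.

Lemma slices_unit w : slices_dom w -> slices w \in unitmx.
Proof.
move=> [wd /(cpt_dom hM) ix]; rewrite /slices /lowered unitmx_mul metric_unit // andbT.
exact: hdelta.
Qed.

Lemma slices_zero y : cod i y -> (slices \o row_mx 0) y = (g i \o cpt i) y.
Proof.
move=> iy; rewrite /= /slices /lowered row_mxKl row_mxKr mxE.
by have [_ _ /(_ i _ (cpt_dom hM iy)) -> _] := halpha; rewrite mul1mx.
Qed.

(** Links the partial derivative in rho of an entry with the derivative of the matrix-valued curve s
    -> alpha s: on the line through (0, x) the entry is a linear function of alpha s, and linear
    maps commute with derivatives. *)
Lemma slice_dr_zero x j k : chart_dom i x ->
  slice_dr slices j k (row_mx 0 (crd i x)) = (family_dot alpha 0 i x *m g i x) j k.
Proof.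
move=> ix; set w0 := row_mx 0 (crd i x); pose e0 : 'rV[R]_(1 + n) := delta_mx 0 (lshift n ord0).
pose Phi (w : 'rV[R]_(1 + n)) := alpha (lsubmx w 0 0) i (cpt i (rsubmx w)).
have lE (s : R) : lsubmx (w0 + s *: e0) 0 0 = s.
  have l0 : lshift n (0 : 'I_1) = lshift n (ord0 : 'I_1) by congr lshift; exact: ord1.
  by rewrite mxE [LHS]mxE [X in _ + X]mxE /e0 l0 /w0 row_mxEl !mxE !eqxx mulr1 add0r.
have rE (s : R) : rsubmx (w0 + s *: e0) = crd i x.
  apply/rowP => b; rewrite mxE [LHS]mxE [X in _ + X]mxE /w0 row_mxEr /e0.
  by rewrite mxE eq_rlshift andbF mulr0 addr0.
pose A (s : R) := alpha s i x.
have AE : A = Phi \o (fun s : R => w0 + s *: e0).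
  by apply/funext => s; rewrite /= /Phi lE rE crdK.
have dA : differentiable A 0.
  have dl : differentiable (cst w0 + ( *:%R^~ e0 : R -> _)) 0 by exact: differentiableD.
  rewrite AE; apply: (differentiable_comp dl).
  apply: (smooth_on_differentiable smooth_alpha).
  by rewrite /= rE; exact: crd_cod.
pose L (B : 'M[R]_n) : R := (B *m g i x) j k.
have Llin : linear L by move=> a B B'; rewrite /L mulmxDl -scalemxAl !mxE.
have Lc : continuous L.
  move=> B; apply: differentiable_continuous.
  apply: (@smooth_on_differentiable _ _ _ setT) => //.
  have oT := @openT 'M[R]_n.
  apply: smooth_on_entry => //; apply: smooth_on_mulmx => //; last exact: smooth_on_cst.
  by apply: (@smooth_on_linear _ _ _ setT id) => // y.
rewrite /slice_dr -[w0 in LHS]addr0 -(scale0r e0) (derive_line (fun w => slices w j k)).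
have -> : (fun s : R => slices (w0 + s *: e0) j k) = L \o A.
  by apply/funext => s; rewrite /slices /lowered lE rE crdK.
by rewrite (derive_linear_comp _ Llin Lc dA) -derive1E.
Qed.

Let adot := family_dot alpha 0.

Definition ricci_defect x : 'M[R]_n :=
  Ric g i x - ((n%:R - 2) / 2) *: lowered g adot i x - (\tr (adot i x) / 2) *: g i x.

Lemma bilin_ricci_defect x v w : bilin (ricci_defect x) v w =
  bilin (Ric g i x) v w - \tr (adot i x) / 2 * bilin (g i x) v w
  - (n%:R - 2) / 2 * bilin (g i x) (v *m adot i x) w.
Proof.
rewrite !bilinB !bilinZ addrAC; congr (_ - _ * _).
by rewrite /bilin /lowered !mulmxA.
Qed.

(** With a = b = 0 this covers natural lifts, with arbitrary a and b all vectors tangent to the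
    scale bundle. *)
Lemma ricci_ambient_metric (q : scale_bundle cg) (l : cidx (ambient M d0)) (a b : 'rV[R]_1) v w :
  l.2.2 = i -> chart_dom l (scale_embedding cg d0 q) ->
  bilin (Ric (ambient_metric d0 g alpha) l (scale_embedding cg d0 q))
    (row_mx a (row_mx 0 v)) (row_mx b (row_mx 0 w)) = bilin (ricci_defect (point_foot q)) v w.
Proof.
move=> li [_ [_ /= lq]]; rewrite li in lq; set x := point_foot q in lq *.
set gt := ambient_metric d0 g alpha; set p := scale_embedding cg d0 q.
set z := crd l p.
have zt : z 0 ix_t = scale_factor g q.
  by rewrite /z /= /ix_t row_mxEl mxE insubdK // inE; exact: scale_factor_gt0.
have zr : z 0 ix_r = 0 by rewrite /z /= /ix_r row_mxEr row_mxEl mxE.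
have zw : rsubmx z = row_mx 0 (crd i x).
  by rewrite /z /= row_mxKr li; congr row_mx; apply/rowP => b'; rewrite !mxE.
have Dz : ambient_dom slices_dom z.
  split; first by rewrite zt scale_factor_gt0.
  by rewrite zw /slices_dom /= row_mxKl row_mxKr mxE normr0; split=> //; exact: crd_cod.
have oD := open_ambient_dom open_slices_dom.
(* On [ambient_dom] the coordinates t and rho lie in the images of their charts, so the default
   values of [insubd] do not intervene. *)
have E : Ric gt l p = ricci_mx (ambient_mx slices) z.
  apply: (ricci_mx_eq oD Dz) => u [u0 [ur ui]].
  have tE : lsubmx u 0 0 = u 0 ix_t by rewrite mxE; congr (u _ _); exact: val_inj.
  have rE : lsubmx (rsubmx u) 0 0 = u 0 ix_r by rewrite !mxE; congr (u _ _); exact: val_inj.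
  rewrite /gt /= /ambient_metric /ambient_mx /= li.
  rewrite !insubdK ?inE /pos_set /sym_set /= ?tE ?rE //.
    by rewrite /slices rE.
  by rewrite -ltr_norml -rE.
rewrite E.
have dr_mx : slice_dr_mx slices z = lowered g adot i x.
  by apply/matrixP => j k; rewrite mxE zw slice_dr_zero.
have gx : slices (rsubmx z) = g i x.
  by rewrite zw; have := slices_zero (crd_cod lq); rewrite /= crdK.
(* At rho = 0 the slice is g and its derivative is adot g; the trace is cyclic. *)
have tr : \tr (invmx (slices (rsubmx z)) *m slice_dr_mx slices z) = \tr (adot i x).
  by rewrite dr_mx gx /lowered mxtrace_mulC -mulmxA (mulmxV (metric_unit lq)) mulmx1.
have ric : ricci_mx (slices \o row_mx 0) (rsubmx (rsubmx z)) = Ric g i x.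
  rewrite zw row_mxKr; apply: (ricci_mx_eq (@open_cod _ _ _ hM i) (crd_cod lq)).
  exact: slices_zero.
apply: bilin_ambient.
- exact: (ricci_ambient_tt open_slices_dom smooth_slices slices_sym slices_unit Dz).
- exact: (ricci_ambient_tm open_slices_dom smooth_slices slices_sym slices_unit Dz).
- exact: (ricci_ambient_mt open_slices_dom smooth_slices slices_sym slices_unit Dz).
move=> j k; rewrite (ricci_ambient_mm open_slices_dom smooth_slices slices_sym slices_unit Dz zr).
have drE : slice_dr slices j k (rsubmx z) = lowered g adot i x j k by rewrite -dr_mx mxE.
rewrite ric tr gx drE /ricci_defect.
move: (Ric g i x) (lowered g adot i x) (g i x) => A B C.
by rewrite !mxE.
Qed.

End InChart.
End AmbientRicci.

(** * The Ricci formula and the two flatness criteria *)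

Theorem corollary3p9 (R : realType) (n : nat) (hn : (2 <= n)%N)
  (M : charted_space R n) (hM : smooth_manifold M)
  (c : set (components M 'M[R]_n)) (hc : conformal_structure c)
  (g : components M 'M[R]_n) (cg : c g)
  (alpha : R -> components M 'M[R]_n) (halpha : admissible c alpha)
  (delta : R) (d0 : 0 < delta) (hdelta : nonsingular_within delta alpha) :
  let Q := scale_bundle cg in
  let Mt := ambient M d0 in
  let gt := ambient_metric d0 g alpha in
  let i_g := scale_embedding cg d0 in
  let adot := family_dot alpha 0 in
  let ricci_flat_along_Q :=
    forall xi eta : components Q 'rV[R]_(1 + n),
      vector_field xi -> vector_field eta ->
      forall (q : Q) (k : cidx Q) (l : cidx Mt), chart_dom k q -> chart_dom l (i_g q) ->
        bilin (Ric gt l (i_g q))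
          (tangent_map i_g xi k l q) (tangent_map i_g eta k l q) = 0 in
  [/\ forall V W : components M 'rV[R]_n, vector_field V -> vector_field W ->
        forall (q : Q) (l : cidx Mt), chart_dom l (i_g q) ->
          let i := l.2.2 in
          let x := point_foot q in
          bilin (Ric gt l (i_g q)) (natural_lift d0 V l (i_g q)) (natural_lift d0 W l (i_g q))
          = bilin (Ric g i x) (V i x) (W i x)
            - \tr (adot i x) / 2 * bilin (g i x) (V i x) (W i x)
            - (n%:R - 2) / 2 * bilin (g i x) (V i x *m adot i x) (W i x),
      n = 2%N ->
        (ricci_flat_along_Q <->
         forall (i : cidx M) (x : M), chart_dom i x ->
           \tr (adot i x) = 2 * gauss_curvature g i x)
    & (3 <= n)%N ->
        (ricci_flat_along_Q <->
         forall (i : cidx M) (x : M), chart_dom i x ->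
           lowered g adot i x = 2 *: Schouten g i x)].
Proof.
move=> Q Mt gt i_g adot flat.
have ricE (q : Q) (l : cidx Mt) a b v w : chart_dom l (i_g q) ->
    bilin (Ric gt l (i_g q)) (row_mx a (row_mx 0 v)) (row_mx b (row_mx 0 w)) =
    bilin (ricci_defect g alpha l.2.2 (point_foot q)) v w.
  by move=> lq; exact: ricci_ambient_metric.
have flatP : flat <-> forall i x, chart_dom i x -> ricci_defect g alpha i x = 0.
  split=> [fl i x ix|defect0 xi eta _ _ q k l kq lq]; last first.
    rewrite !tangent_scale_embedding // ricE //.
    by have [_ [_ lq']] := lq; rewrite defect0 // /bilin mulmx0 mul0mx mxE.
  (* The defect depends on x only, so the single point g_x over x suffices, tested on lifts with t
     component 0. *)
  pose q : Q := section_at cg x; pose l : cidx Mt := (tt, (tt, i)).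
  have lq : chart_dom l (i_g q) by [].
  apply: bilin_eq0 => v w.
  have [X vX XE] := vector_field_extension hM v ix.
  have [Y vY YE] := vector_field_extension hM w ix.
  have lift0 := lift_vector_field hn hM hc cg 0.
  have := fl _ _ (lift0 _ vX) (lift0 _ vY) q i l ix lq.
  by rewrite !tangent_scale_embedding // !row_mxKl !row_mxKr /= jac_id // !mulmx1 XE YE ricE.
split=> [V W _ _ q l lq|n2|n3].
- by rewrite /= [LHS]ricE // bilin_ricci_defect.
- rewrite flatP.
  suff E i x : chart_dom i x -> (ricci_defect g alpha i x = 0) <->
      (\tr (adot i x) = 2 * gauss_curvature g i x).
    by split=> H i x ix; apply/E => //; exact: H.
  (* The term in adot drops out and the defect is (K - tr adot / 2) g, where g is nonzero. *)
  move=> ix; have nn : (n%:R - 2 : R) = 0 by rewrite n2 subrr.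
  rewrite /ricci_defect (ricci_surface hM hc cg n2 ix) nn mul0r scale0r subr0.
  rewrite -scalerBl; have g0 := metric_neq0 hn hc cg ix; split=> [/eqP|->].
    rewrite scaler_eq0 (negbTE g0) orbF subr_eq0 => /eqP ->.
    by rewrite mulrC divfK // pnatr_eq0.
  by rewrite mulrAC divff ?pnatr_eq0 // mul1r subrr scale0r.
rewrite flatP.
suff E i x : chart_dom i x -> (ricci_defect g alpha i x = 0) <->
    (lowered g adot i x = 2 *: Schouten g i x).
  by split=> H i x ix; apply/E => //; exact: H.
move=> ix; have gu := metric_unit hc cg ix.
have trg : \tr (invmx (g i x) *m g i x) = n%:R by rewrite mulVmx // mxtrace1.
have tra : \tr (invmx (g i x) *m lowered g adot i x) = \tr (adot i x).
  by rewrite mxtrace_mulC /lowered -mulmxA mulmxV // mulmx1.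
rewrite /ricci_defect /Schouten; set s := scal g i x.
have sE : \tr (invmx (g i x) *m Ric g i x) = s by [].
have m1 : (n%:R - 1 : R) != 0.
  by rewrite subr_eq0 pnatr_eq1; case: (n) n3 => [|[]].
have m2 : (n%:R - 2 : R) != 0.
  by rewrite subr_eq0 eqr_nat; case: (n) n3 => [|[|[]]].
move: sE tra; move: (lowered g adot i x) (Ric g i x) (g i x) trg => L K h trg sE tra.
have two : (2 : R) != 0 by rewrite pnatr_eq0.
move: (n%:R : R) (\tr (adot i x)) => N a in m1 m2 trg tra *.
split=> E.
  (* The g-trace of the defect is s - (N - 1) a, which forces a = s / (N - 1); with this value the
     equation can be solved for L, as N - 2 is nonzero. *)
  have : \tr (invmx h *m (K - ((N - 2) / 2) *: L - (a / 2) *: h)) = 0.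
    by rewrite E mulmx0 mxtrace0.
  rewrite !mulmxBr -!scalemxAr !raddfB /= !mxtraceZ sE tra trg => F.
  have aE : a = s / (N - 1).
    apply: (canRL (mulfK m1)).
    have -> : s = (s - (N - 2) / 2 * a - a / 2 * N) + a * (N - 1) by field.
    by rewrite F add0r.
  have KE : K = ((N - 2) / 2) *: L + (a / 2) *: h.
    by apply/eqP; rewrite -subr_eq0 opprD addrA E.
  by rewrite KE aE; apply/matrixP => j k; rewrite !mxE; field; rewrite m1 m2.
(* Conversely, the g-trace of twice the Schouten tensor is s / (N - 1). *)
have aE : a = s / (N - 1).
  rewrite -tra E -!scalemxAr mulmxBr -!scalemxAr !mxtraceZ raddfB /= mxtraceZ sE trg.
  by field; rewrite m1 m2.
by rewrite E aE; apply/matrixP => j k; rewrite !mxE; field; rewrite m1 m2.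
Qed.
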